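(* There exists a one-parameter family of solutions of PVI$_\mu$ with $\mu=-\frac12$ of the form $$y(x)=\frac{\frac18\left\{\left[\nu\omega_2+\omega_1+2x(\nu\omega_2'+\omega_1')\right]^2-4x(\nu\omega_2'+\omega_1')^2\right\}^2}{(\nu\omega_2+\omega_1)(\nu\omega_2'+\omega_1')\left[2(x-1)(\nu\omega_2'+\omega_1')+\nu\omega_2+\omega_1\right]\left[\nu\omega_2+\omega_1+2x(\nu\omega_2'+\omega_1')\right]},$$ where $\omega_1(x),\omega_2(x)$ are two linearly independent solutions of the hypergeometric equation $$x(1-x)\omega''(x)+(1-2x)\omega'(x)-\tfrac14\omega(x)=0$$ and $\nu\in\mathbb{C}$ is the parameter.
   Context: PVI$_\mu$ is the equation $$y''=\tfrac12\Big(\tfrac1y+\tfrac1{y-1}+\tfrac1{y-x}\Big)(y')^2-\Big(\tfrac1x+\tfrac1{x-1}+\tfrac1{y-x}\Big)y'+\tfrac12\frac{y(y-1)(y-x)}{x^2(x-1)^2}\Big[(2\mu-1)^2+\frac{x(x-1)}{(y-x)^2}\Big].$$ Primes denote derivatives with respect to $x$. *)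

(* Defs.v *)
From Stdlib Require Import Reals.
From Coquelicot Require Import Coquelicot.

Open Scope C_scope.

(** Complex functions are total functions [C -> C] studied on a subset [U]
    of [C].  The derivative is Coquelicot's complex derivative [C_derive],
    meaningful where [ex_derive] holds (over [C], i.e. complex
    differentiability). *)

Definition connected_open (U : C -> Prop) : Prop :=
  open U /\
  forall A B : C -> Prop, open A -> open B ->
    (forall x, U x <-> A x \/ B x) ->
    (forall x, ~ (A x /\ B x)) ->
    (exists x, A x) -> (exists x, B x) -> False.

(** The multivalued functions on [C \ {0,1}] of the theory are represented by
    their single-valued branches on such domains. *)
Definition PVI_domain (U : C -> Prop) : Prop :=
  connected_open U /\ (exists x, U x) /\
  forall x, U x -> x <> 0 /\ x <> 1.

Definition hypergeometric_solution (U : C -> Prop) (w : C -> C) : Prop :=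
  forall x, U x ->
    ex_derive w x /\ ex_derive (C_derive w) x /\
    x * (1 - x) * C_derive (C_derive w) x + (1 - 2 * x) * C_derive w x
      - 1 / 4 * w x = 0.

Definition linearly_independent_on (U : C -> Prop) (w1 w2 : C -> C) : Prop :=
  forall c1 c2 : C,
    (forall x, U x -> c1 * w1 x + c2 * w2 x = 0) -> c1 = 0 /\ c2 = 0.

Definition hypergeometric_basis (U : C -> Prop) (w1 w2 : C -> C) : Prop :=
  hypergeometric_solution U w1 /\ hypergeometric_solution U w2 /\
  linearly_independent_on U w1 w2.

(** [y] is locally a quotient of holomorphic functions; the values of [y] at
    isolated points (in particular at its poles) are irrelevant. *)
Definition meromorphic_on (U : C -> Prop) (y : C -> C) : Prop :=
  forall p, U p -> exists g h : C -> C,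
    locally p (fun x => ex_derive g x /\ ex_derive h x) /\
    locally' p (fun x => h x <> 0 /\ y x = g x / h x).

(** The right-hand side of PVI is singular where [y] is [0], [1] or [x]. *)
Definition PVI_regular_value (x v : C) : Prop := v <> 0 /\ v <> 1 /\ v <> x.

Definition PVI_eq (mu : C) (y : C -> C) (x : C) : Prop :=
  C_derive (C_derive y) x =
    1 / 2 * (1 / y x + 1 / (y x - 1) + 1 / (y x - x)) * (C_derive y x) ^ 2
    - (1 / x + 1 / (x - 1) + 1 / (y x - x)) * C_derive y x
    + 1 / 2 * (y x * (y x - 1) * (y x - x) / (x ^ 2 * (x - 1) ^ 2))
      * ((2 * mu - 1) ^ 2 + x * (x - 1) / (y x - x) ^ 2).

(** A solution on [U] is a meromorphic function that is not identically [0],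
    [1] or [x] (so that it avoids these values away from isolated points) and
    satisfies the equation wherever it is holomorphic and the right-hand side
    is defined. *)
Definition PVI_solution (mu : C) (U : C -> Prop) (y : C -> C) : Prop :=
  meromorphic_on U y /\
  (forall p, U p -> locally' p (fun x => PVI_regular_value x (y x))) /\
  (forall x, U x -> locally x (fun z => ex_derive y z) ->
     PVI_regular_value x (y x) ->
     ex_derive (C_derive y) x /\ PVI_eq mu y x).

(** Division is total on [C], with [z / 0 = 0]. *)
Definition chazy (w1 w2 : C -> C) (nu : C) (x : C) : C :=
  let f := nu * w2 x + w1 x in
  let f' := nu * C_derive w2 x + C_derive w1 x in
  (1 / 8 * ((f + 2 * x * f') ^ 2 - 4 * x * f' ^ 2) ^ 2)
  / (f * f' * (2 * (x - 1) * f' + f) * (f + 2 * x * f')).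

(* Main.v *)
Require Import Defs.
From Stdlib Require Import Reals Lra Classical ClassicalEpsilon.
From Coquelicot Require Import Coquelicot.

Open Scope C_scope.

(** Local bases exist by power series: the Taylor coefficients of a solution at
    a point other than [0] and [1] satisfy a two-term recurrence whose ratio is
    bounded, so they grow at most geometrically.

    Let [f] be a nontrivial solution, [g] its derivative and [X = x (x - 1)].
    With [D] the denominator of the Chazy function [y],
      [y     = (f^2 + 4 x f g + 4 X g^2)^2 / (8 D)],
      [y - 1 = (f^2 + 4 (x - 1) f g + 4 X g^2)^2 / (8 D)],
      [y - x = (f^2 - 4 X g^2)^2 / (8 D)].
    Since [f] and [g] never vanish together (uniqueness near a common zero, then
    connectedness), the three bases of these squares and the four factors of [D]
    have only simple zeros.  Hence [y] is meromorphic and avoids [0], [1], [x]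
    away from isolated points.

    The quotient [v = f / g] satisfies a Riccati equation, and the square root
    [t] of [y (y - 1)] given by the formulas above is rational in [x] and [v].
    One finds [y' = t w / (2 X)] and [t' = (2 y - 1) w / (4 X)] with
    [w = v - 4 (y - x)], while the Riccati equation becomes
    [(y - x) v' = t (v^2 / (4 X) + 1) - v].  Differentiating [y'] once more
    gives PVI, using no relation other than this one and [t^2 = y (y - 1)]. *)

(** * Complex differentiation: modulus estimates, rules of calculus, isolated zeros *)

Definition is_C_derive (f : C -> C) (z l : C) : Prop :=
  @is_derive C_AbsRing C_NormedModule f z l.

(** The default balls of [C] are squares of the product structure; [locally_C] trades them for discs
    of [Cmod], in which the estimates below are made. *)
Lemma locally_CmodP (p : C) (P : C -> Prop) :
  locally p P <->
  exists d : R, (0 < d)%R /\ forall z, (Cmod (z - p) < d)%R -> P z.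
Proof.
split.
- intros H; apply locally_C in H; destruct H as [d H].
  exists d; split; [apply cond_pos | exact H].
- intros [d [Hd H]]; apply locally_C; exists (mkposreal d Hd); exact H.
Qed.

Lemma is_C_deriveP (f : C -> C) (z l : C) :
  is_C_derive f z l <->
  forall eps : R, (0 < eps)%R -> exists d : R, (0 < d)%R /\
    forall w, (Cmod (w - z) < d)%R ->
      (Cmod (f w - f z - l * (w - z)) <= eps * Cmod (w - z))%R.
Proof.
split.
- intros [_ H] eps Heps.
  destruct (H z (fun P HP => HP) (mkposreal eps Heps)) as [d Hd].
  exists d; split; [apply cond_pos | intros w Hw].
  rewrite (Cmult_comm l); exact (Hd w Hw).
- intros H; split; [apply is_linear_scal_l | intros y Hy eps].
  (* The definition of a differential quantifies over all limits [y] of the filter; uniqueness of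
     limits leaves only [z]. *)
  apply (@is_filter_lim_locally_unique _ (AbsRing_NormedModule C_AbsRing)) in Hy.
  subst y.
  destruct (H eps (cond_pos eps)) as [d [Hd Hf]].
  exists (mkposreal d Hd); intros w Hw.
  specialize (Hf w Hw); rewrite (Cmult_comm l) in Hf; exact Hf.
Qed.

Lemma is_C_derive_eq (f : C -> C) (z l l' : C) :
  is_C_derive f z l -> l = l' -> is_C_derive f z l'.
Proof. intros H <-; exact H. Qed.

Lemma is_C_derive_ext_loc (f g : C -> C) (z l : C) :
  locally z (fun w => f w = g w) -> is_C_derive f z l -> is_C_derive g z l.
Proof.
intros H; apply is_derive_ext_loc, locally_C; exact H.
Qed.

(* [C_NormedModule] and [AbsRing_NormedModule C_AbsRing] have the same norm but
   different balls, so that derivatives over them are not convertible. *)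
Lemma is_C_derive_AbsRing (f : C -> C) (z l : C) :
  @is_derive C_AbsRing (AbsRing_NormedModule C_AbsRing) f z l <->
  is_C_derive f z l.
Proof.
split; intros [_ H]; (split; [apply is_linear_scal_l | exact H]).
Qed.

Lemma is_C_derive_const (c z : C) : is_C_derive (fun _ => c) z 0.
Proof. exact (@is_derive_const C_AbsRing C_NormedModule c z). Qed.

Lemma is_C_derive_id (z : C) : is_C_derive (fun w => w) z 1.
Proof. apply is_C_derive_AbsRing; exact (@is_derive_id C_AbsRing z). Qed.

Lemma is_C_derive_plus (f g : C -> C) (z l m : C) :
  is_C_derive f z l -> is_C_derive g z m ->
  is_C_derive (fun w => f w + g w) z (l + m).
Proof. exact (@is_derive_plus C_AbsRing C_NormedModule f g z l m). Qed.

Lemma is_C_derive_minus (f g : C -> C) (z l m : C) :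
  is_C_derive f z l -> is_C_derive g z m ->
  is_C_derive (fun w => f w - g w) z (l - m).
Proof. exact (@is_derive_minus C_AbsRing C_NormedModule f g z l m). Qed.

Lemma is_C_derive_mult (f g : C -> C) (z l m : C) :
  is_C_derive f z l -> is_C_derive g z m ->
  is_C_derive (fun w => f w * g w) z (l * g z + f z * m).
Proof.
intros Hf Hg; apply is_C_derive_AbsRing.
apply is_C_derive_AbsRing in Hf; apply is_C_derive_AbsRing in Hg.
exact (is_derive_mult f g z l m Hf Hg Cmult_comm).
Qed.

Lemma is_C_derive_scal (c : C) (f : C -> C) (z l : C) :
  is_C_derive f z l -> is_C_derive (fun w => c * f w) z (c * l).
Proof.
intros Hf; eapply is_C_derive_eq;
  [apply is_C_derive_mult; [apply is_C_derive_const | exact Hf] | simpl; ring].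
Qed.

Lemma is_C_derive_sqr (f : C -> C) (z l : C) :
  is_C_derive f z l -> is_C_derive (fun w => f w ^ 2) z (2 * f z * l).
Proof.
intros Hf; eapply is_C_derive_eq.
- apply is_C_derive_mult; [exact Hf|].
  apply is_C_derive_mult; [exact Hf | apply (is_C_derive_const 1)].
- simpl; ring.
Qed.

Lemma is_C_derive_inv_id (z : C) : z <> 0 -> is_C_derive Cinv z (- / z ^ 2).
Proof.
intros Hz; apply is_C_deriveP; intros eps Heps.
assert (Hm : (0 < Cmod z)%R) by now apply Cmod_gt_0.
(* The first bound keeps [Cmod w] at least half of [Cmod z]; the second then controls the remainder
   [(w - z) ^ 2 / (z ^ 2 * w)]. *)
exists (Rmin (Cmod z / 2) (eps * Cmod z ^ 3 / 2)); split.
{ apply Rmin_pos; [lra|].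
  apply Rdiv_lt_0_compat; [apply Rmult_lt_0_compat, pow_lt; lra | lra]. }
intros w Hw.
assert (Hw1 := Rlt_le_trans _ _ _ Hw (Rmin_l _ _)).
assert (Hw2 := Rlt_le_trans _ _ _ Hw (Rmin_r _ _)).
assert (Hwm : (Cmod z / 2 <= Cmod w)%R).
{ assert (H := Cmod_triangle w (- (w - z))).
  rewrite Cmod_opp in H; replace (w + - (w - z)) with z in H by ring; lra. }
assert (Hw0 : w <> 0).
{ intros ->; rewrite Cmod_0 in Hwm; lra. }
replace (/ w - / z - - / z ^ 2 * (w - z)) with ((w - z) * ((w - z) / (z ^ 2 * w)))
  by (field; auto).
rewrite Cmod_mult, Rmult_comm.
apply Rmult_le_compat_r; [apply Cmod_ge_0|].
assert (z ^ 2 <> 0) by now apply Cpow_nz.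
rewrite Cmod_div by now apply Cmult_neq_0.
rewrite Cmod_mult, Cmod_pow.
assert (Hp : (0 < Cmod z ^ 2)%R) by now apply pow_lt.
apply Rle_div_l; [apply Rmult_lt_0_compat; lra|].
apply Rle_trans with (1 := Rlt_le _ _ Hw2).
replace (eps * Cmod z ^ 3 / 2)%R with (eps * (Cmod z ^ 2 * (Cmod z / 2)))%R by field.
apply Rmult_le_compat_l; [lra|]; apply Rmult_le_compat_l; lra.
Qed.

Lemma is_C_derive_inv (f : C -> C) (z l : C) :
  f z <> 0 -> is_C_derive f z l ->
  is_C_derive (fun w => / f w) z (- l / f z ^ 2).
Proof.
intros Hz Hf; apply is_C_derive_AbsRing in Hf; eapply is_C_derive_eq.
- exact (is_derive_comp Cinv f z _ _ (is_C_derive_inv_id _ Hz) Hf).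
- change (l * (- / f z ^ 2) = - l / f z ^ 2); field; exact Hz.
Qed.

Lemma is_C_derive_div (f g : C -> C) (z l m : C) :
  g z <> 0 -> is_C_derive f z l -> is_C_derive g z m ->
  is_C_derive (fun w => f w / g w) z ((l * g z - f z * m) / g z ^ 2).
Proof.
intros Hz Hf Hg; eapply is_C_derive_eq.
- exact (is_C_derive_mult _ _ _ _ _ Hf (is_C_derive_inv _ _ _ Hz Hg)).
- cbv beta; field; exact Hz.
Qed.

Lemma is_C_derive_near (f : C -> C) (z l : C) (e : R) :
  is_C_derive f z l -> (0 < e)%R ->
  locally z (fun w => (Cmod (f w - f z) < e)%R).
Proof.
intros Hf He; apply locally_CmodP.
destruct (proj1 (is_C_deriveP _ _ _) Hf 1%R Rlt_0_1) as [d [Hd H]].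
assert (Hl := Cmod_ge_0 l).
exists (Rmin d (e / (1 + Cmod l))); split.
{ apply Rmin_pos, Rdiv_lt_0_compat; lra. }
intros w Hw.
assert (Hw1 := Rlt_le_trans _ _ _ Hw (Rmin_l _ _)).
assert (Hw2 := Rlt_le_trans _ _ _ Hw (Rmin_r _ _)).
replace (f w - f z) with ((f w - f z - l * (w - z)) + l * (w - z)) by ring.
apply Rle_lt_trans with (1 := Cmod_triangle _ _).
rewrite Cmod_mult; specialize (H w Hw1).
apply Rlt_div_r in Hw2; lra.
Qed.

Lemma is_C_derive_neq_0 (f : C -> C) (z l : C) :
  is_C_derive f z l -> f z <> 0 -> locally z (fun w => f w <> 0).
Proof.
intros Hf Hz; apply Cmod_gt_0 in Hz.
apply filter_imp with (2 := is_C_derive_near _ _ _ _ Hf Hz).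
intros w Hw H0; rewrite H0 in Hw.
replace (0 - f z) with (- f z) in Hw by ring; rewrite Cmod_opp in Hw; lra.
Qed.

Lemma Cminus_eq_0 (a b : C) : a - b = 0 -> a = b.
Proof. intros E; replace a with ((a - b) + b) by ring; rewrite E; ring. Qed.

Lemma locally'_of_locally (p : C) (P : C -> Prop) : locally p P -> locally' p P.
Proof. unfold locally', within; apply filter_imp; auto. Qed.

(** At a simple zero the error is at most half of the linear term [l * (w - z)], too small to cancel
    it when [w] differs from [z]; elsewhere continuity suffices. *)
Lemma is_C_derive_isolated_zero (f : C -> C) (z l : C) :
  is_C_derive f z l -> (f z = 0 -> l <> 0) -> locally' z (fun w => f w <> 0).
Proof.
intros Hf Hl; destruct (excluded_middle_informative (f z = 0)) as [Hz | Hz].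
- apply locally_CmodP; specialize (Hl Hz); apply Cmod_gt_0 in Hl.
  destruct (proj1 (is_C_deriveP _ _ _) Hf (Cmod l / 2)%R) as [d [Hd H]]; [lra|].
  exists d; split; [exact Hd|]; intros w Hw Hwz Hw0.
  specialize (H w Hw); rewrite Hz, Hw0 in H.
  replace (0 - 0 - l * (w - z)) with (- (l * (w - z))) in H by ring.
  rewrite Cmod_opp, Cmod_mult in H.
  assert (Hp : (0 < Cmod (w - z))%R).
  { apply Cmod_gt_0; intros E; apply Hwz, Cminus_eq_0, E. }
  nra.
- exact (locally'_of_locally _ _ (is_C_derive_neq_0 _ _ _ Hf Hz)).
Qed.

(** * Complex power series *)

Definition CSeries (a : nat -> C) : C :=
  (Series (fun n => Re (a n)), Series (fun n => Im (a n))).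

Definition abs_summable (a : nat -> C) : Prop := ex_series (fun n => Cmod (a n)).

Lemma abs_summable_le (a : nat -> C) (b : nat -> R) :
  (forall n, (Cmod (a n) <= b n)%R) -> ex_series b -> abs_summable a.
Proof.
intros H; apply (@ex_series_le R_AbsRing R_CompleteNormedModule); intros n.
change (Rabs (Cmod (a n)) <= b n)%R.
rewrite Rabs_pos_eq by apply Cmod_ge_0; apply H.
Qed.

Lemma im_le_Cmod (z : C) : (Rabs (Im z) <= Cmod z)%R.
Proof. exact (Rle_trans _ _ _ (Rmax_r _ _) (Rmax_Cmod z)). Qed.

Lemma abs_summable_Re (a : nat -> C) :
  abs_summable a -> ex_series (fun n => Re (a n)).
Proof.
apply (@ex_series_le R_AbsRing R_CompleteNormedModule); intros n.
apply re_le_Cmod.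
Qed.

Lemma abs_summable_Im (a : nat -> C) :
  abs_summable a -> ex_series (fun n => Im (a n)).
Proof.
apply (@ex_series_le R_AbsRing R_CompleteNormedModule); intros n.
apply im_le_Cmod.
Qed.

Lemma abs_summable_plus (a b : nat -> C) :
  abs_summable a -> abs_summable b -> abs_summable (fun n => a n + b n).
Proof.
intros Ha Hb; apply abs_summable_le with (2 := ex_series_plus _ _ Ha Hb).
intros n; apply Cmod_triangle.
Qed.

Lemma abs_summable_scal (c : C) (a : nat -> C) :
  abs_summable a -> abs_summable (fun n => c * a n).
Proof.
intros Ha; apply abs_summable_le with (b := fun n => (Cmod c * Cmod (a n))%R).
- intros n; rewrite Cmod_mult; apply Rle_refl.
- apply (ex_series_scal_l (Cmod c) _ Ha).
Qed.

Lemma CSeries_plus (a b : nat -> C) :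
  abs_summable a -> abs_summable b ->
  CSeries (fun n => a n + b n) = CSeries a + CSeries b.
Proof.
intros Ha Hb; apply injective_projections; simpl; apply Series_plus;
  auto using abs_summable_Re, abs_summable_Im.
Qed.

Lemma CSeries_scal (c : C) (a : nat -> C) :
  abs_summable a -> CSeries (fun n => c * a n) = c * CSeries a.
Proof.
intros Ha.
assert (Hr := abs_summable_Re _ Ha); assert (Hi := abs_summable_Im _ Ha).
apply injective_projections; simpl; rewrite <- !Series_scal_l.
- apply Series_minus.
  + apply (ex_series_scal_l (fst c) _ Hr).
  + apply (ex_series_scal_l (snd c) _ Hi).
- apply Series_plus.
  + apply (ex_series_scal_l (fst c) _ Hi).
  + apply (ex_series_scal_l (snd c) _ Hr).
Qed.

Lemma CSeries_ext (a b : nat -> C) :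
  (forall n, a n = b n) -> CSeries a = CSeries b.
Proof.
intros H; apply injective_projections; simpl; apply Series_ext; intros n;
  now rewrite H.
Qed.

Lemma CSeries_incr_1 (a : nat -> C) :
  abs_summable a -> CSeries a = a 0%nat + CSeries (fun n => a (S n)).
Proof.
intros Ha; apply injective_projections; simpl; apply Series_incr_1;
  auto using abs_summable_Re, abs_summable_Im.
Qed.

Lemma Series_0 (a : nat -> R) : (forall n, a n = 0%R) -> Series a = 0%R.
Proof.
intros H; rewrite (Series_ext a (fun n => (0 * a n)%R)).
- rewrite Series_scal_l; ring.
- intros n; rewrite H; ring.
Qed.

Lemma CSeries_0 (a : nat -> C) : (forall n, a n = 0) -> CSeries a = 0.
Proof.
intros H; apply injective_projections; simpl; apply Series_0; intros n;
  now rewrite H.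
Qed.

(** Real and imaginary parts are each bounded by [Series b]; passing to the modulus costs [sqrt 2],
    rounded up to 2. *)
Lemma Cmod_CSeries_le (a : nat -> C) (b : nat -> R) :
  (forall n, (Cmod (a n) <= b n)%R) -> ex_series b ->
  (Cmod (CSeries a) <= 2 * Series b)%R.
Proof.
intros H Hb.
assert (Hp : forall p : C -> R, (forall z, (Rabs (p z) <= Cmod z)%R) ->
  (Rabs (Series (fun n => p (a n))) <= Series b)%R).
{ intros p Hp.
  assert (Hpb : forall n, (0 <= Rabs (p (a n)) <= b n)%R).
  { intros n; split; [apply Rabs_pos | exact (Rle_trans _ _ _ (Hp _) (H n))]. }
  apply Rle_trans with (2 := Series_le _ _ Hpb Hb).
  apply Series_Rabs.
  apply (@ex_series_le R_AbsRing R_CompleteNormedModule) with (2 := Hb).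
  intros n; simpl; unfold norm; simpl; unfold abs; simpl.
  rewrite Rabs_Rabsolu; apply Hpb. }
assert (Hre := Hp Re re_le_Cmod); assert (Him := Hp Im im_le_Cmod).
apply Rle_trans with (1 := Cmod_2Rmax _); simpl.
assert (Hs : (0 <= sqrt 2 <= 2)%R).
{ split; [apply sqrt_pos|].
  rewrite <- (sqrt_Rsqr 2) at 2 by lra; apply sqrt_le_1; unfold Rsqr; lra. }
apply Rmult_le_compat; [lra | apply Rle_trans with (2 := Rmax_l _ _), Rabs_pos
  | lra | now apply Rmax_lub].
Qed.

Definition CPSeries (c : nat -> C) (t : C) : C := CSeries (fun n => c n * t ^ n).

(** An explicit form of a positive radius of convergence: the series converges absolutely for
    [M * Cmod t < 1]. *)
Definition geometric_bound (c : nat -> C) (K M : R) : Prop :=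
  (0 <= K)%R /\ (0 < M)%R /\ forall n, (Cmod (c n) <= K * M ^ n)%R.

Definition derive_coef (c : nat -> C) (n : nat) : C :=
  RtoC (INR (S n)) * c (S n).

Lemma INR_S_le_pow2 (n : nat) : (INR (S n) <= 2 ^ n)%R.
Proof.
induction n as [|n IH]; [simpl; lra|].
rewrite S_INR; simpl (2 ^ S n)%R.
assert (1 <= 2 ^ n)%R by (apply pow_R1_Rle; lra); lra.
Qed.

(** The factor [n + 1] is absorbed by [2 ^ n], so each differentiation doubles the growth rate. *)
Lemma geometric_bound_derive (c : nat -> C) (K M : R) :
  geometric_bound c K M -> geometric_bound (derive_coef c) (K * M) (2 * M).
Proof.
intros [HK [HM H]]; split; [|split]; [apply Rmult_le_pos; lra | lra |].
intros n; unfold derive_coef.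
rewrite Cmod_mult, Cmod_R, Rabs_pos_eq by apply pos_INR.
rewrite Rpow_mult_distr.
replace (K * M * (2 ^ n * M ^ n))%R with (2 ^ n * (K * M ^ S n))%R
  by (simpl; ring).
apply Rmult_le_compat; [apply pos_INR | apply Cmod_ge_0 | apply INR_S_le_pow2
  | apply H].
Qed.

Lemma geometric_bound_summable (c : nat -> C) (K M : R) (t : C) :
  geometric_bound c K M -> (M * Cmod t < 1)%R ->
  abs_summable (fun n => c n * t ^ n).
Proof.
intros [HK [HM H]] Ht.
apply abs_summable_le with (b := fun n => (K * (M * Cmod t) ^ n)%R).
- intros n; rewrite Cmod_mult, Cmod_pow, Rpow_mult_distr, <- Rmult_assoc.
  apply Rmult_le_compat_r; [apply pow_le, Cmod_ge_0 | apply H].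
- apply (ex_series_scal_l K (fun n => (M * Cmod t) ^ n)%R), ex_series_geom.
  rewrite Rabs_pos_eq; [exact Ht | apply Rmult_le_pos, Cmod_ge_0; lra].
Qed.

(** Multiplication by [t] shifts coefficients. The shifted sequence [g] is specified pointwise so
    that it can be supplied in closed form. *)
Lemma CPSeries_mult_var (c g : nat -> C) (t : C) :
  g 0%nat = 0 -> (forall n, g (S n) = c n) ->
  abs_summable (fun n => c n * t ^ n) ->
  abs_summable (fun n => g n * t ^ n) /\ CPSeries g t = t * CPSeries c t.
Proof.
intros H0 HS Hc.
assert (Hs : forall n, g (S n) * t ^ S n = t * (c n * t ^ n)).
{ intros n; rewrite HS; simpl; ring. }
assert (Hg : abs_summable (fun n => g n * t ^ n)).
{ apply ex_series_incr_1.
  apply (ex_series_ext (fun n => Cmod (t * (c n * t ^ n)))).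
  - intros n; now rewrite <- Hs.
  - now apply abs_summable_scal. }
split; [exact Hg|].
unfold CPSeries; rewrite CSeries_incr_1, H0 by exact Hg.
rewrite (CSeries_ext _ _ Hs), CSeries_scal by exact Hc; ring.
Qed.

(** Induction: the next remainder is [(t + h)] times the present one plus [n h^2 t^(n-1)]. The two
    terms contribute at most [r] and [3 * r], whence the rate [4 * r]; the factor [r ^ 2] avoids a
    division. *)
Lemma Cpow_taylor_bound (t h : C) (r : R) (n : nat) :
  (Cmod t + Cmod h <= r)%R ->
  (Cmod ((t + h) ^ n - t ^ n - RtoC (INR n) * h * t ^ pred n) * r ^ 2
    <= Cmod h ^ 2 * (4 * r) ^ n)%R.
Proof.
intros Hr.
assert (Ht := Cmod_ge_0 t); assert (Hh := Cmod_ge_0 h).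
assert (Hr0 : (0 <= r)%R) by lra.
induction n as [|n IH].
- replace ((t + h) ^ 0 - t ^ 0 - RtoC (INR 0) * h * t ^ pred 0) with (RtoC 0)
    by (simpl; ring).
  rewrite Cmod_0; simpl; nra.
- replace ((t + h) ^ S n - t ^ S n - RtoC (INR (S n)) * h * t ^ pred (S n))
    with ((t + h) * ((t + h) ^ n - t ^ n - RtoC (INR n) * h * t ^ pred n)
          + RtoC (INR n) * h ^ 2 * t ^ pred n).
  (* At [n = 0] the truncated [pred n] is harmless, because the coefficient [INR 0] kills its
     term. *)
  2:{ rewrite S_INR, RtoC_plus; destruct n as [|n]; simpl; ring. }
  set (e := (t + h) ^ n - t ^ n - RtoC (INR n) * h * t ^ pred n) in *.
  assert (H1 : (Cmod ((t + h) * e) * r ^ 2 <= r * (Cmod h ^ 2 * (4 * r) ^ n))%R).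
  { rewrite Cmod_mult, Rmult_assoc; apply Rmult_le_compat;
      [apply Cmod_ge_0 | apply Rmult_le_pos, pow_le, Hr0; apply Cmod_ge_0 | | exact IH].
    apply Rle_trans with (1 := Cmod_triangle _ _); exact Hr. }
  assert (H2 : (Cmod (RtoC (INR n) * h ^ 2 * t ^ pred n) * r ^ 2
                <= 3 * r * (Cmod h ^ 2 * (4 * r) ^ n))%R).
  { rewrite !Cmod_mult, !Cmod_pow, Cmod_R, Rabs_pos_eq by apply pos_INR.
    assert (Hn : (INR n * (Cmod t ^ pred n * r ^ 2) <= 4 ^ n * r ^ S n)%R).
    { destruct n as [|n]; [simpl; lra|].
      apply Rmult_le_compat; [apply pos_INR | | |].
      - apply Rmult_le_pos; apply pow_le; lra.
      - apply Rle_trans with (1 := INR_S_le_pow2 n).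
        apply Rle_trans with (4 ^ n)%R; [apply pow_incr; lra | simpl].
        assert (0 <= 4 ^ n)%R by (apply pow_le; lra); lra.
      - replace (r ^ S (S n))%R with (r ^ n * r ^ 2)%R by (simpl; ring).
        apply Rmult_le_compat_r; [apply pow_le; lra | apply pow_incr; simpl; lra]. }
    replace (3 * r * (Cmod h ^ 2 * (4 * r) ^ n))%R
      with (3 * (Cmod h ^ 2 * (4 ^ n * r ^ S n)))%R
      by (rewrite Rpow_mult_distr; simpl; ring).
    assert (H3 : (0 <= Cmod h ^ 2)%R) by (apply pow_le; lra).
    assert (H4 : (0 <= 4 ^ n * r ^ S n)%R)
      by (apply Rmult_le_pos; apply pow_le; lra).
    assert (H5 := Rmult_le_compat_l _ _ _ H3 Hn).
    assert (H6 := Rmult_le_pos _ _ H3 H4); nra. }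
  apply Rle_trans with
    ((Cmod ((t + h) * e) + Cmod (RtoC (INR n) * h ^ 2 * t ^ pred n)) * r ^ 2)%R.
  + apply Rmult_le_compat_r; [apply pow_le; lra | apply Cmod_triangle].
  + replace (Cmod h ^ 2 * (4 * r) ^ S n)%R
      with (4 * r * (Cmod h ^ 2 * (4 * r) ^ n))%R by (simpl; ring); lra.
Qed.

(* The radius is a quarter of the guaranteed one: the factor 4 absorbs the
   polynomial growth in [Cpow_taylor_bound]. *)
Lemma is_C_derive_CPSeries (c : nat -> C) (K M : R) (t : C) :
  geometric_bound c K M -> (4 * M * Cmod t < 1)%R ->
  is_C_derive (CPSeries c) t (CPSeries (derive_coef c) t).
Proof.
intros Hc Ht.
assert (Ht0 := Cmod_ge_0 t).
destruct Hc as [HK [HM Hc]].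
assert (Hc' : geometric_bound c K M) by (split; auto).
(* The midpoint leaves room for [h] around [t] while keeping the geometric ratio [M * (4 * r)] below
   1. *)
set (r := ((Cmod t + / (4 * M)) / 2)%R).
assert (Hi : (Cmod t < / (4 * M))%R).
{ apply (Rmult_lt_reg_l (4 * M)); [lra|]; rewrite Rinv_r; lra. }
assert (Htr : (Cmod t < r)%R) by (unfold r; lra).
assert (Hr : (M * (4 * r) < 1)%R).
{ replace 1%R with (4 * M * / (4 * M))%R by (field; lra).
  replace (M * (4 * r))%R with (4 * M * r)%R by ring.
  apply Rmult_lt_compat_l; unfold r; lra. }
assert (Hgeo : ex_series (fun n => (K / r ^ 2 * (M * (4 * r)) ^ n)%R)).
{ apply (ex_series_scal_l (K / r ^ 2)%R (fun n => (M * (4 * r)) ^ n)%R).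
  apply ex_series_geom; rewrite Rabs_pos_eq; [exact Hr|].
  apply Rmult_le_pos; lra. }
set (Q := Series (fun n => (K / r ^ 2 * (M * (4 * r)) ^ n)%R)).
assert (Hr2 : (0 < r ^ 2)%R) by (apply pow_lt; lra).
assert (HQ : (0 <= Q)%R).
{ unfold Q; rewrite <- (Series_0 (fun _ => 0%R)) by reflexivity.
  apply Series_le; [intros n; split; [lra|] | exact Hgeo].
  apply Rmult_le_pos; [apply Rdiv_le_0_compat; lra | apply pow_le].
  apply Rmult_le_pos; lra. }
assert (Hquad : forall h, (Cmod h <= r - Cmod t)%R ->
  (Cmod (CPSeries c (t + h)%C - CPSeries c t - CPSeries (derive_coef c) t * h)
    <= 2 * (Cmod h ^ 2 * Q))%R).
{ intros h Hh.
  assert (Hth : (M * Cmod (t + h)%C < 1)%R).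
  { assert (H := Cmod_triangle t h); nra. }
  assert (S1 := geometric_bound_summable _ _ _ _ Hc' Hth).
  assert (S2 : abs_summable (fun n => c n * t ^ n)).
  { apply (geometric_bound_summable _ _ _ _ Hc'); nra. }
  assert (S3 : abs_summable (fun n => derive_coef c n * t ^ n)).
  { apply (geometric_bound_summable _ _ _ _ (geometric_bound_derive _ _ _ Hc')).
    nra. }
  (* The derived series without its index shift, so that the three series can be combined term by
     term; its zeroth term vanishes. *)
  set (g := fun n => RtoC (INR n) * c n * t ^ pred n).
  assert (S4 : abs_summable g).
  { apply ex_series_incr_1; exact S3. }
  assert (E4 : CPSeries (derive_coef c) t = CSeries g).
  { rewrite (CSeries_incr_1 g S4); unfold g at 1; simpl (INR 0).
    unfold CPSeries.
    rewrite (CSeries_ext (fun n => g (S n)) (fun n => derive_coef c n * t ^ n))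
      by reflexivity.
    ring. }
  assert (E : CPSeries c (t + h) - CPSeries c t - CPSeries (derive_coef c) t * h
    = CSeries (fun n =>
        (c n * (t + h) ^ n + - (1) * (c n * t ^ n)) + - h * g n)).
  { rewrite CSeries_plus, CSeries_plus, !CSeries_scal, E4;
      auto using abs_summable_plus, abs_summable_scal.
    unfold CPSeries; ring. }
  rewrite E.
  replace (Cmod h ^ 2 * Q)%R
    with (Series (fun n => (Cmod h ^ 2 * (K / r ^ 2 * (M * (4 * r)) ^ n))%R))
    by apply Series_scal_l.
  apply Cmod_CSeries_le.
  - intros n; unfold g.
    replace (c n * (t + h) ^ n + - (1) * (c n * t ^ n)
             + - h * (RtoC (INR n) * c n * t ^ pred n))
      with (c n * ((t + h) ^ n - t ^ n - RtoC (INR n) * h * t ^ pred n)) by ring.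
    rewrite Cmod_mult.
    assert (HT := Cpow_taylor_bound t h r n ltac:(lra)).
    apply Rle_div_r in HT; [|exact Hr2].
    rewrite Rpow_mult_distr.
    replace (Cmod h ^ 2 * (K / r ^ 2 * (M ^ n * (4 * r) ^ n)))%R
      with ((K * M ^ n) * (Cmod h ^ 2 * (4 * r) ^ n / r ^ 2))%R by (field; lra).
    apply Rmult_le_compat; auto using Cmod_ge_0.
  - apply (ex_series_scal_l (Cmod h ^ 2)%R _ Hgeo). }
apply is_C_deriveP; intros eps Heps.
(* The summand 1 avoids a division by zero when [Q = 0]. *)
exists (Rmin (r - Cmod t) (eps / (2 * Q + 1))); split.
{ apply Rmin_pos; [lra | apply Rdiv_lt_0_compat; lra]. }
intros w Hw.
assert (Hw1 := Rlt_le_trans _ _ _ Hw (Rmin_l _ _)).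
assert (Hw2 := Rlt_le_trans _ _ _ Hw (Rmin_r _ _)).
assert (H := Hquad (w - t) (Rlt_le _ _ Hw1)).
replace (t + (w - t)) with w in H by ring.
apply Rle_trans with (1 := H).
assert (Hp := Cmod_ge_0 (w - t)).
apply Rlt_div_r in Hw2; [|lra].
replace (2 * (Cmod (w - t) ^ 2 * Q))%R
  with ((Cmod (w - t) * (2 * Q)) * Cmod (w - t))%R by (simpl; ring).
apply Rmult_le_compat_r; [exact Hp | nra].
Qed.

(** * Local solutions of the hypergeometric equation *)

(** Carrying two consecutive coefficients makes the two-step recurrence structural. It comes from
    the coefficient of [t^n] in [(a + b t - t^2) w'' + (b - 2 t) w' - w / 4 = 0], where
    [n (n - 1) + 2 n + 1/4 = (n + 1/2)^2]. *)
Fixpoint hypergeometric_coef_pair (a b c0 c1 : C) (n : nat) : C * C :=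
  match n with
  | O => (c0, c1)
  | S n =>
      let p := hypergeometric_coef_pair a b c0 c1 n in
      (snd p,
       ((RtoC (INR n) + 1 / 2) ^ 2 * fst p - b * RtoC (INR (S n)) ^ 2 * snd p)
       / (a * RtoC (INR (S (S n))) * RtoC (INR (S n))))
  end.

(* Taylor coefficients at [x0] of the solution with value [c0] and slope [c1],
   where [a = x0 (1 - x0)] and [b = 1 - 2 x0]. *)
Definition hypergeometric_coef (a b c0 c1 : C) (n : nat) : C :=
  fst (hypergeometric_coef_pair a b c0 c1 n).

Lemma INR_S_neq_0 (n : nat) : RtoC (INR (S n)) <> 0.
Proof. intros H; apply RtoC_inj in H; exact (not_0_INR (S n) (Nat.neq_succ_0 n) H). Qed.

Lemma hypergeometric_coef_SS (a b c0 c1 : C) (n : nat) :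
  hypergeometric_coef a b c0 c1 (S (S n)) =
  ((RtoC (INR n) + 1 / 2) ^ 2 * hypergeometric_coef a b c0 c1 n
   - b * RtoC (INR (S n)) ^ 2 * hypergeometric_coef a b c0 c1 (S n))
  / (a * RtoC (INR (S (S n))) * RtoC (INR (S n))).
Proof. reflexivity. Qed.

(** In the recurrence both weights [(n + 1/2)^2] and [(n + 1)^2] are dominated by [(n + 1) (n + 2)],
    which leaves the factor [q = (Cmod b + 1) / Cmod a]. Adding 1 to [q] makes the bounds increase
    with [n], so that the later of two consecutive bounds covers both. *)
Lemma hypergeometric_coef_bound (a b c0 c1 : C) :
  a <> 0 ->
  geometric_bound (hypergeometric_coef a b c0 c1) (Cmod c0 + Cmod c1)
    (1 + (Cmod b + 1) / Cmod a).
Proof.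
intros Ha.
assert (Hap : (0 < Cmod a)%R) by now apply Cmod_gt_0.
assert (Hb := Cmod_ge_0 b); assert (H0 := Cmod_ge_0 c0).
assert (H1 := Cmod_ge_0 c1).
set (K := (Cmod c0 + Cmod c1)%R).
set (q := ((Cmod b + 1) / Cmod a)%R).
assert (Hq : (0 < q)%R) by (apply Rdiv_lt_0_compat; lra).
split; [unfold K; lra | split; [lra|]].
set (M := (1 + q)%R).
assert (Hboth : forall n,
  (Cmod (hypergeometric_coef a b c0 c1 n) <= K * M ^ n)%R /\
  (Cmod (hypergeometric_coef a b c0 c1 (S n)) <= K * M ^ S n)%R);
  [|intros n; apply Hboth].
induction n as [|n [IH1 IH2]].
- unfold hypergeometric_coef; simpl; unfold K, M; split; nra.
- split; [exact IH2|].
  rewrite hypergeometric_coef_SS.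
  set (u := hypergeometric_coef a b c0 c1 n) in *.
  set (v := hypergeometric_coef a b c0 c1 (S n)) in *.
  assert (Hs : RtoC (INR (S n)) <> 0) by apply INR_S_neq_0.
  assert (Hss : RtoC (INR (S (S n))) <> 0) by apply INR_S_neq_0.
  rewrite Cmod_div by (repeat apply Cmult_neq_0; assumption).
  rewrite !Cmod_mult, !Cmod_R, !Rabs_pos_eq by apply pos_INR.
  assert (Hn := pos_INR n).
  rewrite !S_INR; set (m := INR n) in *.
  assert (Hnum : (Cmod ((RtoC m + 1 / 2) ^ 2 * u - b * (RtoC (m + 1)) ^ 2 * v)
     <= (m + 1) ^ 2 * (Cmod u + Cmod b * Cmod v))%R).
  { apply Rle_trans with (1 := Cmod_triangle _ _).
    rewrite Cmod_opp, !Cmod_mult, !Cmod_pow.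
    replace (RtoC m + 1 / 2) with (RtoC (m + 1 / 2))
      by (rewrite RtoC_plus, RtoC_div; [reflexivity | lra]).
    rewrite !Cmod_R, !Rabs_pos_eq by lra.
    assert (Hu := Cmod_ge_0 u).
    assert ((m + 1 / 2) ^ 2 <= (m + 1) ^ 2)%R by (apply pow_incr; lra).
    nra. }
  assert (HM : (0 <= K * M ^ n)%R).
  { apply Rmult_le_pos; [unfold K; lra | apply pow_le; unfold M; lra]. }
  assert (Huv : (Cmod u + Cmod b * Cmod v <= (K * M ^ S n) * (q * Cmod a))%R).
  { replace (q * Cmod a)%R with (Cmod b + 1)%R by (unfold q; field; lra).
    simpl (M ^ S n)%R in *; unfold M in *; nra. }
  apply Rle_div_l; [nra|].
  apply Rle_trans with (1 := Hnum).
  assert (HKM : (0 <= K * M ^ S n)%R) by (simpl; unfold M in *; nra).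
  apply Rle_trans with ((m + 1) ^ 2 * ((K * M ^ S n) * (q * Cmod a)))%R.
  { apply Rmult_le_compat_l; [apply pow_le; lra | exact Huv]. }
  replace (K * M ^ S (S n) * (Cmod a * (m + 1 + 1) * (m + 1)))%R
    with ((M * (m + 2) * (m + 1)) * (K * M ^ S n * Cmod a))%R by (simpl; ring).
  replace ((m + 1) ^ 2 * ((K * M ^ S n) * (q * Cmod a)))%R
    with ((q * (m + 1) ^ 2) * (K * M ^ S n * Cmod a))%R by ring.
  apply Rmult_le_compat_r; [nra|]; unfold M; nra.
Qed.

Lemma CPSeries_0 (c : nat -> C) (K M : R) :
  geometric_bound c K M -> CPSeries c 0 = c 0%nat.
Proof.
intros Hc; unfold CPSeries; rewrite CSeries_incr_1.
- rewrite CSeries_0; [simpl; ring | intros n; simpl; ring].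
- apply geometric_bound_summable with (1 := Hc); rewrite Cmod_0; lra.
Qed.

(** Comparison of coefficients. The factor 4 pays for two differentiations, each of which doubles
    the growth rate. *)
Lemma hypergeometric_CPSeries (a b c0 c1 t : C) (K M : R) :
  a <> 0 -> geometric_bound (hypergeometric_coef a b c0 c1) K M ->
  (4 * M * Cmod t < 1)%R ->
  let c := hypergeometric_coef a b c0 c1 in
  (a + b * t - t ^ 2) * CPSeries (derive_coef (derive_coef c)) t
  + (b - 2 * t) * CPSeries (derive_coef c) t - 1 / 4 * CPSeries c t = 0.
Proof.
intros Ha Hc Ht c.
assert (Ht0 := Cmod_ge_0 t).
assert (Hd := geometric_bound_derive _ _ _ Hc).
assert (Hdd := geometric_bound_derive _ _ _ Hd).
destruct Hc as [HK [HM Hc']].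
assert (S0 : abs_summable (fun n => c n * t ^ n)).
{ apply (geometric_bound_summable c K M); [split; auto | nra]. }
assert (S1 := geometric_bound_summable _ _ _ t Hd ltac:(nra)).
assert (S2 := geometric_bound_summable _ _ _ t Hdd ltac:(nra)).
fold c in S1, S2.
(* The three sequences introduced here are the coefficients of [t w'], [t w''] and [t^2 w'']. *)
destruct (CPSeries_mult_var (derive_coef c)
  (fun n => RtoC (INR n) * c n) t) as [S3 E3]; [simpl; ring | reflexivity | exact S1 |].
destruct (CPSeries_mult_var (derive_coef (derive_coef c))
  (fun n => RtoC (INR n) * derive_coef c n) t) as [S4 E4];
  [simpl; ring | reflexivity | exact S2 |].
destruct (CPSeries_mult_var (fun n => RtoC (INR n) * derive_coef c n)
  (fun n => (RtoC (INR n) - 1) * RtoC (INR n) * c n) t) as [S5 E5];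
  [simpl; ring | | exact S4 |].
{ intros n; unfold derive_coef; rewrite (S_INR n), RtoC_plus; ring. }
replace ((a + b * t - t ^ 2) * CPSeries (derive_coef (derive_coef c)) t
  + (b - 2 * t) * CPSeries (derive_coef c) t - 1 / 4 * CPSeries c t)
with (a * CPSeries (derive_coef (derive_coef c)) t
  + b * (t * CPSeries (derive_coef (derive_coef c)) t)
  + - (1) * (t * (t * CPSeries (derive_coef (derive_coef c)) t))
  + b * CPSeries (derive_coef c) t
  + - (2) * (t * CPSeries (derive_coef c) t)
  + - (1 / 4) * CPSeries c t) by ring.
rewrite <- E4, <- E5, <- E3; unfold CPSeries.
rewrite <- !CSeries_scal by assumption.
rewrite <- !CSeries_plus by auto 10 using abs_summable_plus, abs_summable_scal.
apply CSeries_0; intros n; unfold derive_coef.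
unfold c; rewrite hypergeometric_coef_SS.
assert (Hs := INR_S_neq_0 n); assert (Hss := INR_S_neq_0 (S n)).
assert (E : RtoC (INR (S (S n))) = RtoC (INR n) + 2).
{ rewrite !S_INR, !RtoC_plus; ring. }
assert (E' : RtoC (INR (S n)) = RtoC (INR n) + 1).
{ now rewrite S_INR, RtoC_plus. }
rewrite E in *; rewrite E' in *; field; auto.
Qed.

(** By convexity, the segment from a point of [A] to a point of [B] stays in the disc; on it the
    mean value theorem excludes a jump between the two sets. *)
Lemma connected_open_ball (x0 : C) (r : R) :
  connected_open (fun x => (Cmod (x - x0) < r)%R).
Proof.
split.
- intros x Hx; apply locally_CmodP; exists (r - Cmod (x - x0))%R; split; [lra|].
  intros z Hz; replace (z - x0) with ((z - x) + (x - x0)) by ring.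
  apply Rle_lt_trans with (1 := Cmod_triangle _ _); lra.
- intros A B HA HB HU Hdisj [p Hp] [q Hq].
  set (gam := fun s : R => p + RtoC s * (q - p)).
  (* The indicator of [A] along the segment from [p] to [q] is locally
     constant, hence has zero derivative. *)
  set (h := fun s => if excluded_middle_informative (A (gam s)) then 0%R else 1%R).
  assert (Hpre : forall (V : C -> Prop) s, open V -> V (gam s) ->
    locally s (fun s' => V (gam s'))).
  { intros V s HV Hs; apply HV, locally_CmodP in Hs; destruct Hs as [d [Hd H]].
    assert (Hpq := Cmod_ge_0 (q - p)).
    assert (He : (0 < d / (1 + Cmod (q - p)))%R) by (apply Rdiv_lt_0_compat; lra).
    exists (mkposreal _ He); intros s' Hs'; apply H.
    change (Rabs (s' - s) < d / (1 + Cmod (q - p)))%R in Hs'.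
    replace (gam s' - gam s) with (RtoC (s' - s) * (q - p))
      by (unfold gam; rewrite RtoC_minus; ring).
    rewrite Cmod_mult, Cmod_R; apply Rlt_div_r in Hs'; [|lra].
    assert (Ha := Rabs_pos (s' - s)); nra. }
  assert (Hconv : forall s, (0 <= s <= 1)%R -> (Cmod (gam s - x0) < r)%R).
  { intros s Hs.
    assert (Up := proj2 (HU p) (or_introl Hp)).
    assert (Uq := proj2 (HU q) (or_intror Hq)).
    replace (gam s - x0)
      with (RtoC (1 - s) * (p - x0) + RtoC s * (q - x0))
      by (unfold gam; rewrite RtoC_minus; ring).
    apply Rle_lt_trans with (1 := Cmod_triangle _ _).
    rewrite !Cmod_mult, !Cmod_R, !Rabs_pos_eq by lra.
    assert (Hm := Rmax_lub_lt _ _ _ Up Uq); cbv beta in Hm.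
    assert (Mp := Rmax_l (Cmod (p - x0)) (Cmod (q - x0))).
    assert (Mq := Rmax_r (Cmod (p - x0)) (Cmod (q - x0))).
    nra. }
  assert (Hder : forall s, (0 <= s <= 1)%R -> is_derive h s 0%R).
  { intros s Hs; destruct (proj1 (HU _) (Hconv s Hs)) as [HAs | HBs].
    - apply (is_derive_ext_loc (fun _ => 0%R));
        [|exact (@is_derive_const R_AbsRing R_NormedModule _ s)].
      apply filter_imp with (2 := Hpre A s HA HAs); intros s' Hs'.
      unfold h; now destruct excluded_middle_informative.
    - apply (is_derive_ext_loc (fun _ => 1%R));
        [|exact (@is_derive_const R_AbsRing R_NormedModule _ s)].
      apply filter_imp with (2 := Hpre B s HB HBs); intros s' Hs'.
      unfold h; destruct excluded_middle_informative as [HAs'|]; [|reflexivity].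
      now destruct (Hdisj (gam s')). }
  destruct (MVT_gen h 0 1 (fun _ => 0%R)) as [s [_ Hs]].
  { rewrite Rmin_left, Rmax_right by lra; intros s Hs; apply Hder; lra. }
  { rewrite Rmin_left, Rmax_right by lra; intros s Hs.
    apply continuity_pt_filterlim, (ex_derive_continuous h).
    eexists; now apply Hder. }
  replace (h 1%R) with 1%R in Hs; [replace (h 0%R) with 0%R in Hs; [lra|]|].
  + unfold h, gam; destruct excluded_middle_informative as [|H]; [reflexivity|].
    destruct H; now replace (p + RtoC 0 * (q - p)) with p by ring.
  + unfold h, gam; destruct excluded_middle_informative as [H|]; [|reflexivity].
    destruct (Hdisj q); split; [|exact Hq].
    now replace (p + RtoC 1 * (q - p)) with q in H by ring.
Qed.

Lemma is_C_derive_shift (f : C -> C) (x0 x l : C) :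
  is_C_derive f (x - x0) l -> is_C_derive (fun z => f (z - x0)) x l.
Proof.
rewrite !is_C_deriveP; intros H eps Heps.
destruct (H eps Heps) as [d [Hd Hf]]; exists d; split; [exact Hd|].
intros w; replace (w - x) with ((w - x0) - (x - x0)) by ring; apply Hf.
Qed.

(** The factor 8 lets the derived series, of growth rate [2 * M], be differentiated once more on the
    whole disc. *)
Lemma hypergeometric_local_solution (x0 c0 c1 : C) (M r : R) :
  x0 * (1 - x0) <> 0 ->
  geometric_bound (hypergeometric_coef (x0 * (1 - x0)) (1 - 2 * x0) c0 c1)
    (Cmod c0 + Cmod c1) M ->
  (8 * M * r <= 1)%R -> (0 < r)%R ->
  exists w, hypergeometric_solution (fun x => (Cmod (x - x0) < r)%R) w /\
    w x0 = c0 /\ C_derive w x0 = c1.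
Proof.
intros Ha Hc Hr Hr0.
assert (Hd := geometric_bound_derive _ _ _ Hc).
set (c := hypergeometric_coef (x0 * (1 - x0)) (1 - 2 * x0) c0 c1) in *.
assert (HM : (0 < M)%R) by apply Hc.
assert (D1 : forall x, (Cmod (x - x0) < r)%R ->
  is_C_derive (fun x => CPSeries c (x - x0)) x (CPSeries (derive_coef c) (x - x0))).
{ intros x Hx; apply is_C_derive_shift, (is_C_derive_CPSeries _ _ _ _ Hc).
  assert (H := Cmod_ge_0 (x - x0)); nra. }
assert (E1 : forall x, (Cmod (x - x0) < r)%R ->
  C_derive (fun x => CPSeries c (x - x0)) x = CPSeries (derive_coef c) (x - x0)).
{ intros x Hx; apply is_C_derive_unique, D1, Hx. }
assert (D2 : forall x, (Cmod (x - x0) < r)%R ->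
  is_C_derive (C_derive (fun x => CPSeries c (x - x0))) x
    (CPSeries (derive_coef (derive_coef c)) (x - x0))).
{ intros x Hx; apply is_C_derive_ext_loc with
    (f := fun x => CPSeries (derive_coef c) (x - x0)).
  - apply (proj1 (connected_open_ball x0 r)) in Hx; revert Hx.
    apply filter_imp; intros z Hz; symmetry; now apply E1.
  - apply is_C_derive_shift, (is_C_derive_CPSeries _ _ _ _ Hd).
    assert (H := Cmod_ge_0 (x - x0)); nra. }
exists (fun x => CPSeries c (x - x0)); split; [|split].
- intros x Hx; split; [|split].
  + eexists; now apply D1.
  + eexists; now apply D2.
  + rewrite (is_C_derive_unique _ _ _ (D2 x Hx)), (E1 x Hx).
    rewrite <- (hypergeometric_CPSeries (x0 * (1 - x0)) (1 - 2 * x0) c0 c1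
      (x - x0) _ M Ha Hc).
    * fold c; ring.
    * assert (H := Cmod_ge_0 (x - x0)); nra.
- replace (x0 - x0) with (RtoC 0) by ring; exact (CPSeries_0 _ _ _ Hc).
- rewrite E1; replace (x0 - x0) with (RtoC 0) by ring.
  + rewrite (CPSeries_0 _ _ _ Hd); unfold derive_coef, c, hypergeometric_coef.
    simpl; ring.
  + now rewrite Cmod_0.
Qed.

(** The basis has Cauchy data [(1, 0)] and [(0, 1)] at [x0], so the coefficients of a combination
    are its value and slope there. *)
Lemma hypergeometric_basis_exists (x0 : C) :
  x0 <> 0 -> x0 <> 1 ->
  exists (U : C -> Prop) (w1 w2 : C -> C),
    PVI_domain U /\ U x0 /\ hypergeometric_basis U w1 w2.
Proof.
intros H0 H1.
assert (H1' : 1 - x0 <> 0) by (intros E; now apply H1, eq_sym, Cminus_eq_0).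
assert (Ha : x0 * (1 - x0) <> 0) by now apply Cmult_neq_0.
assert (B1 := hypergeometric_coef_bound _ (1 - 2 * x0) 1 0 Ha).
assert (B2 := hypergeometric_coef_bound _ (1 - 2 * x0) 0 1 Ha).
set (M := (1 + (Cmod (1 - 2 * x0)%C + 1) / Cmod (x0 * (1 - x0))%C)%R) in *.
assert (HM : (0 < M)%R) by apply B1.
assert (P0 : (0 < Cmod x0)%R) by now apply Cmod_gt_0.
assert (P1 : (0 < Cmod (1 - x0)%C)%R) by now apply Cmod_gt_0.
(* The first bound gives convergence, the other two keep 0 and 1 out of the open disc. One [M]
   serves both solutions, as it depends only on [x0]. *)
set (r := Rmin (/ (8 * M)) (Rmin (Cmod x0) (Cmod (1 - x0)%C))).
assert (Hi : (0 < / (8 * M))%R) by (apply Rinv_0_lt_compat; lra).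
assert (Hr : (0 < r)%R) by (repeat apply Rmin_pos; assumption).
assert (Hr8 : (8 * M * r <= 1)%R).
{ rewrite <- (Rinv_r (8 * M)) by lra; apply Rmult_le_compat_l; [lra|].
  apply Rmin_l. }
assert (Hr0 : (r <= Cmod x0)%R)
  by exact (Rle_trans _ _ _ (Rmin_r _ _) (Rmin_l _ _)).
assert (Hr1 : (r <= Cmod (1 - x0)%C)%R)
  by exact (Rle_trans _ _ _ (Rmin_r _ _) (Rmin_r _ _)).
destruct (hypergeometric_local_solution x0 1 0 M r Ha B1 Hr8 Hr)
  as [w1 [S1 [V1 D1]]].
destruct (hypergeometric_local_solution x0 0 1 M r Ha B2 Hr8 Hr)
  as [w2 [S2 [V2 D2]]].
assert (HU0 : (Cmod (x0 - x0)%C < r)%R)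
  by (replace (x0 - x0) with (RtoC 0) by ring; now rewrite Cmod_0).
exists (fun x => (Cmod (x - x0) < r)%R), w1, w2.
split; [split; [apply connected_open_ball | split] | split; [exact HU0|]].
- now exists x0.
- intros x Hx; split; intros ->; [|lra].
  replace (0 - x0) with (- x0) in Hx by ring; rewrite Cmod_opp in Hx; lra.
- split; [exact S1 | split; [exact S2|]]; intros c1 c2 H.
  split.
  + rewrite <- (H x0 HU0), V1, V2; ring.
  + apply (@eq_trans _ _ (c1 * C_derive w1 x0 + c2 * C_derive w2 x0));
      [rewrite D1, D2; ring|].
    assert (D : is_C_derive (fun x => c1 * w1 x + c2 * w2 x) x0
      (c1 * C_derive w1 x0 + c2 * C_derive w2 x0)).
    { apply is_C_derive_plus; apply is_C_derive_scal, C_derive_correct; auto;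
        [apply S1 | apply S2]; exact HU0. }
    rewrite <- (is_C_derive_unique _ _ _ D); apply is_C_derive_unique.
    apply is_C_derive_ext_loc with (f := fun _ => 0);
      [|apply is_C_derive_const].
    generalize (proj1 (connected_open_ball x0 r) x0 HU0); apply filter_imp.
    intros z Hz; symmetry; now apply H.
Qed.

(** * Uniqueness *)

(** Reduces complex derivatives to real ones along a segment, where the mean value theorem applies;
    [pr] will be [Re] or [Im]. The denominators [1 + Cmod e] allow [e = 0]. *)
Lemma is_derive_along_segment (pr : C -> R) (f : C -> C) (p e l : C) (s : R) :
  (forall a b, pr (a + b) = (pr a + pr b)%R) ->
  (forall (k : R) a, pr (RtoC k * a) = (k * pr a)%R) ->
  (forall a, (Rabs (pr a) <= Cmod a)%R) ->
  is_C_derive f (p + RtoC s * e) l ->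
  is_derive (fun s => pr (f (p + RtoC s * e))) s (pr (l * e)).
Proof.
intros Hadd Hscal Hle Hf.
split; [apply is_linear_scal_l | intros y Hy eps].
apply (@is_filter_lim_locally_unique _ (AbsRing_NormedModule R_AbsRing)) in Hy.
subst y.
assert (He := Cmod_ge_0 e).
assert (Heps : (0 < eps / (1 + Cmod e))%R)
  by (apply Rdiv_lt_0_compat; [apply cond_pos | lra]).
destruct (proj1 (is_C_deriveP _ _ _) Hf _ Heps) as [d [Hd H]].
assert (Hd' : (0 < d / (1 + Cmod e))%R) by (apply Rdiv_lt_0_compat; lra).
exists (mkposreal _ Hd'); intros s' Hs'.
change (Rabs (s' - s) < d / (1 + Cmod e))%R in Hs'.
change (Rabs (pr (f (p + RtoC s' * e)%C) - pr (f (p + RtoC s * e)%C)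
  - (s' - s) * pr (l * e)%C) <= eps * Rabs (s' - s))%R.
replace (pr (f (p + RtoC s' * e)%C) - pr (f (p + RtoC s * e)%C)
  - (s' - s) * pr (l * e)%C)%R
  with (pr (f (p + RtoC s' * e) - f (p + RtoC s * e)
            - l * ((p + RtoC s' * e) - (p + RtoC s * e)))).
2:{ replace (f (p + RtoC s' * e) - f (p + RtoC s * e)
            - l * ((p + RtoC s' * e) - (p + RtoC s * e)))
      with (f (p + RtoC s' * e) + RtoC (-1) * f (p + RtoC s * e)
            + RtoC (-(s' - s)) * (l * e))
      by (replace (-1)%R with (- (1))%R by ring;
          rewrite !RtoC_opp, RtoC_minus; ring).
    rewrite !Hadd, !Hscal; ring. }
apply Rle_trans with (1 := Hle _).
assert (Ha := Rabs_pos (s' - s)).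
assert (E : Cmod ((p + RtoC s' * e) - (p + RtoC s * e)) = (Rabs (s' - s) * Cmod e)%R).
{ replace ((p + RtoC s' * e) - (p + RtoC s * e)) with (RtoC (s' - s) * e)
    by (rewrite RtoC_minus; ring).
  now rewrite Cmod_mult, Cmod_R. }
apply Rlt_div_r in Hs'; [|lra].
apply Rle_trans with (1 := H _ ltac:(rewrite E; nra)); rewrite E.
apply Rle_trans with (eps / (1 + Cmod e) * (Rabs (s' - s) * (1 + Cmod e)))%R.
- apply Rmult_le_compat_l; nra.
- right; field; lra.
Qed.

(** Cauchy-Schwarz: the real inner product is the real part of [a * Cconj b]. *)
Lemma Re_Im_inner_le (a b : C) :
  (Re a * Re b + Im a * Im b <= Cmod a * Cmod b)%R.
Proof.
replace (Re a * Re b + Im a * Im b)%R with (Re (a * Cconj b))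
  by (unfold Re, Im; simpl; ring).
rewrite <- (Cmod_conj b), <- Cmod_mult.
exact (Rle_trans _ _ _ (Rle_abs _) (re_le_Cmod _)).
Qed.

Lemma is_derive_eq (f : R -> R) (x l l' : R) :
  is_derive f x l -> l = l' -> is_derive f x l'.
Proof. intros H <-; exact H. Qed.

Lemma is_derive_sum_sqr (a b c d : R -> R) (x a' b' c' d' : R) :
  is_derive a x a' -> is_derive b x b' -> is_derive c x c' -> is_derive d x d' ->
  is_derive (fun s => (a s ^ 2 + b s ^ 2 + c s ^ 2 + d s ^ 2)%R) x
    (2 * (a x * a' + b x * b' + c x * c' + d x * d'))%R.
Proof.
intros A1 A2 A3 A4; auto_derive; [repeat split; eexists; eassumption|].
rewrite (is_derive_unique (fun s : R => a s) _ _ A1),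
  (is_derive_unique (fun s : R => b s) _ _ A2),
  (is_derive_unique (fun s : R => c s) _ _ A3),
  (is_derive_unique (fun s : R => d s) _ _ A4); ring.
Qed.

(* Gronwall along the segment from [p] to [z] for the energy |u|^2 + |v|^2. *)
Lemma linear_system_unique (u v al be : C -> C) (p : C) (d M : R) :
  (forall z, (Cmod (z - p) < d)%R ->
    is_C_derive u z (v z) /\ is_C_derive v z (al z * u z + be z * v z) /\
    (Cmod (al z) <= M)%R /\ (Cmod (be z) <= M)%R) ->
  u p = 0 -> v p = 0 ->
  forall z, (Cmod (z - p) < d)%R -> u z = 0 /\ v z = 0.
Proof.
intros H Hu Hv z Hz.
set (e := z - p) in *.
assert (He := Cmod_ge_0 e).
set (gam := fun s => p + RtoC s * e).
assert (Hin : forall s, (0 <= s <= 1)%R -> (Cmod (gam s - p) < d)%R).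
{ intros s Hs; replace (gam s - p) with (RtoC s * e) by (unfold gam; ring).
  rewrite Cmod_mult, Cmod_R, Rabs_pos_eq by lra; nra. }
set (q := fun z => al z * u z + be z * v z).
set (En := fun s => (Re (u (gam s)) ^ 2 + Im (u (gam s)) ^ 2
                  + Re (v (gam s)) ^ 2 + Im (v (gam s)) ^ 2)%R).
set (dEn := fun s =>
  (2 * (Re (u (gam s)) * Re (v (gam s) * e)%C + Im (u (gam s)) * Im (v (gam s) * e)%C)
   + 2 * (Re (v (gam s)) * Re (q (gam s) * e)%C
          + Im (v (gam s)) * Im (q (gam s) * e)%C))%R).
(* With [a], [b] the moduli of [u], [v], the derivative of the energy is at most [Cmod e] times
   [2 a b + 2 b (M a + M b)], and [2 a b <= a^2 + b^2] bounds the latter by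
   [(1 + 3 M) (a^2 + b^2)]. *)
set (K := (Cmod e * (1 + 3 * M))%R).
assert (HE : forall s, En s = (Cmod (u (gam s)) ^ 2 + Cmod (v (gam s)) ^ 2)%R).
{ intros s; rewrite !Cmod2_alt; unfold En; ring. }
assert (Hre : forall f l s, is_C_derive f (gam s) l ->
  is_derive (fun s => Re (f (gam s))) s (Re (l * e))).
{ intros f l s; apply is_derive_along_segment.
  - reflexivity.
  - intros k a; unfold Re, Im; simpl; ring.
  - apply re_le_Cmod. }
assert (Him : forall f l s, is_C_derive f (gam s) l ->
  is_derive (fun s => Im (f (gam s))) s (Im (l * e))).
{ intros f l s; apply is_derive_along_segment.
  - reflexivity.
  - intros k a; unfold Re, Im; simpl; ring.
  - apply im_le_Cmod. }
assert (HdE : forall s, (0 <= s <= 1)%R -> is_derive En s (dEn s)).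
{ intros s Hs; destruct (H _ (Hin s Hs)) as [D1 [D2 _]].
  assert (A1 := Hre _ _ _ D1); assert (A2 := Him _ _ _ D1).
  assert (A3 := Hre _ _ _ D2); assert (A4 := Him _ _ _ D2).
  eapply is_derive_eq; [exact (is_derive_sum_sqr _ _ _ _ _ _ _ _ _ A1 A2 A3 A4)|].
  unfold dEn, q; ring. }
assert (Hbound : forall s, (0 <= s <= 1)%R -> (dEn s <= K * En s)%R).
{ intros s Hs; destruct (H _ (Hin s Hs)) as [_ [_ [HA HB]]].
  rewrite HE; unfold dEn, K.
  assert (I1 := Re_Im_inner_le (u (gam s)) (v (gam s) * e)).
  assert (I2 := Re_Im_inner_le (v (gam s)) (q (gam s) * e)).
  rewrite Cmod_mult in I1, I2.
  assert (I3 : (Cmod (q (gam s)) <= M * Cmod (u (gam s)) + M * Cmod (v (gam s)))%R).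
  { apply Rle_trans with (1 := Cmod_triangle _ _); rewrite !Cmod_mult.
    apply Rplus_le_compat; apply Rmult_le_compat_r; auto using Cmod_ge_0. }
  assert (HM := Rle_trans _ _ _ (Cmod_ge_0 _) HA).
  assert (Pu := Cmod_ge_0 (u (gam s))); assert (Pv := Cmod_ge_0 (v (gam s))).
  set (a := Cmod (u (gam s))) in *; set (b := Cmod (v (gam s))) in *.
  assert (I4 : (b * (Cmod (q (gam s)) * Cmod e)
                <= b * ((M * a + M * b) * Cmod e))%R).
  { apply Rmult_le_compat_l, Rmult_le_compat_r; assumption. }
  assert (I6 := Rmult_le_pos _ _ (Rmult_le_pos _ _ He HM) (pow2_ge_0 (a - b))).
  assert (I7 := Rmult_le_pos _ _ He (pow2_ge_0 (a - b))).
  assert (I8 := Rmult_le_pos _ _ (Rmult_le_pos _ _ He HM) (pow2_ge_0 a)).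
  assert (I9 := Rmult_le_pos _ _ (Rmult_le_pos _ _ He HM) (pow2_ge_0 b)).
  clear - I1 I2 I4 I6 I7 I8 I9; lra. }
(* The damped energy has nonpositive derivative and starts at 0, so it is nonpositive at [s = 1];
   the energy being a sum of squares, it vanishes there. *)
assert (HG : forall s, (0 <= s <= 1)%R ->
  is_derive (fun s => En s * exp (- K * s))%R s
    ((dEn s - K * En s) * exp (- K * s))%R).
{ intros s Hs; assert (A := HdE s Hs); clearbody En.
  auto_derive; [eexists; exact A|].
  rewrite (is_derive_unique (fun s : R => En s) _ _ A); ring. }
destruct (MVT_gen (fun s => En s * exp (- K * s))%R 0 1
  (fun s => (dEn s - K * En s) * exp (- K * s))%R) as [s [Hs HMVT]].
- rewrite Rmin_left, Rmax_right by lra; intros s Hs; apply HG; lra.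
- rewrite Rmin_left, Rmax_right by lra; intros s Hs.
  apply continuity_pt_filterlim.
  apply (ex_derive_continuous (fun s => En s * exp (- K * s))%R).
  eexists; apply HG, Hs.
- rewrite Rmin_left, Rmax_right in Hs by lra.
  assert (Hneg := Hbound s Hs).
  assert (Hexp := exp_pos (- K * s)); assert (Hexp1 := exp_pos (- K * 1)).
  assert (E0 : En 0%R = 0%R).
  { rewrite HE; unfold gam; replace (p + RtoC 0 * e) with p by ring.
    rewrite Hu, Hv, Cmod_0; ring. }
  rewrite E0 in HMVT.
  assert (E1 : (En 1%R <= 0)%R) by nra.
  rewrite HE in E1; unfold gam in E1.
  replace (p + RtoC 1 * e) with z in E1 by (unfold e; ring).
  assert (P1 := Cmod_ge_0 (u z)); assert (P2 := Cmod_ge_0 (v z)).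
  split; apply Cmod_eq_0; nra.
Qed.

(** The equation as a first-order linear system for a solution and its derivative, the form that the
    uniqueness estimate takes. *)
Definition hypergeometric_system (U : C -> Prop) (f g : C -> C) : Prop :=
  forall x, U x ->
    is_C_derive f x (g x) /\
    is_C_derive g x ((f x / 4 - (1 - 2 * x) * g x) / (x * (1 - x))).

Lemma hypergeometric_system_of_solution (U : C -> Prop) (w : C -> C) :
  PVI_domain U -> hypergeometric_solution U w ->
  hypergeometric_system U w (C_derive w).
Proof.
intros [_ [_ HU]] Hw x Hx; destruct (Hw x Hx) as [E1 [E2 E]].
destruct (HU x Hx) as [H0 H1].
assert (H1' : 1 - x <> 0) by (intros K; now apply H1, eq_sym, Cminus_eq_0).
split; [now apply C_derive_correct|].
eapply is_C_derive_eq; [now apply C_derive_correct|].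
transitivity ((x * (1 - x) * C_derive (C_derive w) x) / (x * (1 - x)));
  [now field; auto|].
f_equal; apply Cminus_eq_0; rewrite <- E; field.
Qed.

Lemma hypergeometric_system_comb (U : C -> Prop) (f1 g1 f2 g2 : C -> C) (nu : C) :
  PVI_domain U ->
  hypergeometric_system U f1 g1 -> hypergeometric_system U f2 g2 ->
  hypergeometric_system U (fun x => nu * f2 x + f1 x) (fun x => nu * g2 x + g1 x).
Proof.
intros [_ [_ HU]] H1 H2 x Hx; destruct (HU x Hx) as [N0 N1].
assert (N1' : 1 - x <> 0) by (intros K; now apply N1, eq_sym, Cminus_eq_0).
destruct (H1 x Hx) as [A1 B1]; destruct (H2 x Hx) as [A2 B2].
split; [apply is_C_derive_plus; [now apply is_C_derive_scal | exact A1]|].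
eapply is_C_derive_eq;
  [apply is_C_derive_plus; [apply is_C_derive_scal, B2 | exact B1]|].
field; auto.
Qed.

(** Near [p] the coefficients of the system are bounded by their moduli at [p] plus 1, so the
    uniqueness estimate applies on a disc. *)
Lemma hypergeometric_system_zero_open (U : C -> Prop) (f g : C -> C) (p : C) :
  PVI_domain U -> hypergeometric_system U f g -> U p -> f p = 0 -> g p = 0 ->
  locally p (fun x => U x /\ f x = 0 /\ g x = 0).
Proof.
intros [[HO _] [_ HU]] Hs Hp Hf Hg.
set (al := fun x : C => 1 / (4 * (x * (1 - x)))).
set (be := fun x : C => (2 * x - 1) / (x * (1 - x))).
destruct (HU p Hp) as [N0 N1].
assert (Np : 1 - p <> 0) by (intros K; now apply N1, eq_sym, Cminus_eq_0).
assert (Hq : is_C_derive (fun x => x * (1 - x)) p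
  (1 * (1 - p) + p * (0 - 1))).
{ apply is_C_derive_mult; [apply is_C_derive_id|].
  apply is_C_derive_minus; [apply is_C_derive_const | apply is_C_derive_id]. }
assert (N4 : RtoC 4 <> 0) by (intros K; apply RtoC_inj in K; lra).
assert (Hal := is_C_derive_div (fun _ => 1) (fun x => 4 * (x * (1 - x))) p _ _
  (Cmult_neq_0 _ _ N4 (Cmult_neq_0 _ _ N0 Np))
  (is_C_derive_const 1 p) (is_C_derive_scal 4 _ _ _ Hq)).
assert (Hbe := is_C_derive_div (fun x => 2 * x - 1) (fun x => x * (1 - x)) p _ _
  (Cmult_neq_0 _ _ N0 Np)
  (is_C_derive_minus _ _ _ _ _ (is_C_derive_scal 2 _ _ _ (is_C_derive_id p))
    (is_C_derive_const 1 p)) Hq).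
assert (Lal := is_C_derive_near _ _ _ _ Hal Rlt_0_1).
assert (Lbe := is_C_derive_near _ _ _ _ Hbe Rlt_0_1).
destruct (proj1 (locally_CmodP _ _)
  (filter_and _ _ (HO p Hp) (filter_and _ _ Lal Lbe))) as [d [Hd H]].
cbv beta in H; fold (al p) (be p) in H.
set (M := Rmax (Cmod (al p) + 1) (Cmod (be p) + 1)).
assert (Hnear : forall a b : C, (Cmod (a - b) < 1)%R -> (Cmod a <= Cmod b + 1)%R).
{ intros a b Hab; replace a with ((a - b) + b) by ring.
  apply Rle_trans with (1 := Cmod_triangle _ _); lra. }
apply locally_CmodP; exists d; split; [exact Hd|]; intros z Hz.
split; [now apply H|].
apply (linear_system_unique f g al be p d M); auto.
intros x Hx; destruct (H x Hx) as [Ux [Ax Bx]]; destruct (Hs x Ux) as [D1 D2].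
destruct (HU x Ux) as [M0 M1].
assert (Mx : 1 - x <> 0) by (intros K; now apply M1, eq_sym, Cminus_eq_0).
split; [exact D1 | split; [|split]].
- eapply is_C_derive_eq; [exact D2|]; unfold al, be; field; auto.
- apply Rle_trans with (2 := Rmax_l _ _), Hnear, Ax.
- apply Rle_trans with (2 := Rmax_r _ _), Hnear, Bx.
Qed.

(** The common zeros of [f] and [g] form an open set by local uniqueness, the other points of [U]
    one by continuity; connectedness forbids both to be nonempty. *)
Lemma hypergeometric_system_nonzero (U : C -> Prop) (f g : C -> C) :
  PVI_domain U -> hypergeometric_system U f g ->
  (exists x, U x /\ f x <> 0) -> forall x, U x -> f x = 0 -> g x <> 0.
Proof.
intros HU Hs [a [Ua Ha]] x Ux Hf Hg.
destruct (proj1 HU) as [HO Hconn].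
apply (Hconn (fun z => U z /\ f z = 0 /\ g z = 0)
  (fun z => U z /\ ~ (f z = 0 /\ g z = 0))).
- intros z [Uz [Fz Gz]].
  exact (hypergeometric_system_zero_open U f g z HU Hs Uz Fz Gz).
- intros z [Uz Nz]; destruct (Hs z Uz) as [D1 D2].
  apply (filter_and _ _ (HO z Uz)).
  destruct (excluded_middle_informative (f z = 0)) as [Fz | Fz].
  + assert (Gz : g z <> 0) by tauto.
    generalize (is_C_derive_neq_0 _ _ _ D2 Gz); apply filter_imp; tauto.
  + generalize (is_C_derive_neq_0 _ _ _ D1 Fz); apply filter_imp; tauto.
- intros z; destruct (classic (f z = 0 /\ g z = 0)); tauto.
- tauto.
- exists x; auto.
- exists a; tauto.
Qed.

(** * The differential equation of the Chazy function *)

(* Syntax-directed, because unification with the wrong rule unfolds the complex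
   operations and diverges. *)
Ltac C_deriv :=
  lazymatch goal with
  | |- is_C_derive (fun _ => ?c) _ _ => apply (is_C_derive_const c)
  | |- is_C_derive (fun z => z) _ _ => apply is_C_derive_id
  | |- is_C_derive (fun z => (@?f z + @?g z)%C) _ _ =>
      apply (is_C_derive_plus f g); C_deriv
  | |- is_C_derive (fun z => (@?f z - @?g z)%C) _ _ =>
      apply (is_C_derive_minus f g); C_deriv
  | |- is_C_derive (fun z => (@?f z * @?g z)%C) _ _ =>
      apply (is_C_derive_mult f g); C_deriv
  | |- is_C_derive (fun z => (@?f z / @?g z)%C) _ _ =>
      apply (is_C_derive_div f g); [cbv beta; auto | C_deriv | C_deriv]
  | |- is_C_derive (fun z => (@?f z ^ 2)%C) _ _ =>
      apply (is_C_derive_sqr f); C_deriv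
  | |- _ => eassumption
  end.

(* With [v = f / f'], the hypergeometric equation becomes the Riccati equation
   [v' = riccati x v], and the Chazy function becomes [chazy_of_quotient x v]. *)
Definition riccati (x v : C) : C :=
  (v ^ 2 / 4 - (1 - 2 * x) * v) / (x * (x - 1)) + 1.

Definition chazy_of_quotient (x v : C) : C :=
  1 / 8 * (v ^ 2 + 4 * x * v + 4 * x * (x - 1)) ^ 2
  / (v * (2 * (x - 1) + v) * (v + 2 * x)).

(* A square root of [y * (y - 1)] for [y = chazy_of_quotient x v]. *)
Definition chazy_sqrt (x v : C) : C :=
  1 / 8 * (v ^ 2 + 4 * x * v + 4 * x * (x - 1))
    * (v ^ 2 + 4 * (x - 1) * v + 4 * x * (x - 1))
  / (v * (2 * (x - 1) + v) * (v + 2 * x)).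

Definition chazy_weight (x v : C) : C := v - 4 * (chazy_of_quotient x v - x).

Definition chazy_slope (x v : C) : C :=
  chazy_sqrt x v * chazy_weight x v / (2 * (x * (x - 1))).

Record chazy_regular (x v : C) : Prop := {
  chazy_regular_x : x <> 0;
  chazy_regular_x1 : x - 1 <> 0;
  chazy_regular_v : v <> 0;
  chazy_regular_a : 2 * (x - 1) + v <> 0;
  chazy_regular_b : v + 2 * x <> 0 }.

Lemma RtoC_neq_0 (r : R) : r <> 0%R -> RtoC r <> 0.
Proof. intros H E; now apply RtoC_inj in E. Qed.

Lemma is_C_derive_chazy_of_quotient (v : C -> C) (x : C) :
  chazy_regular x (v x) -> is_C_derive v x (riccati x (v x)) ->
  is_C_derive (fun z => chazy_of_quotient z (v z)) x (chazy_slope x (v x)).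
Proof.
intros [H0 H1 Hv Ha Hb] Dv.
assert (Hden : v x * (2 * (x - 1) + v x) * (v x + 2 * x) <> 0)
  by (repeat apply Cmult_neq_0; assumption).
unfold chazy_of_quotient; eapply is_C_derive_eq; [C_deriv|].
unfold chazy_slope, chazy_sqrt, chazy_weight, chazy_of_quotient, riccati.
field; repeat split; assumption.
Qed.

Lemma is_C_derive_chazy_sqrt (v : C -> C) (x : C) :
  chazy_regular x (v x) -> is_C_derive v x (riccati x (v x)) ->
  is_C_derive (fun z => chazy_sqrt z (v z)) x
    ((2 * chazy_of_quotient x (v x) - 1) * chazy_weight x (v x) / (4 * (x * (x - 1)))).
Proof.
intros [H0 H1 Hv Ha Hb] Dv.
assert (Hden : v x * (2 * (x - 1) + v x) * (v x + 2 * x) <> 0)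
  by (repeat apply Cmult_neq_0; assumption).
unfold chazy_sqrt; eapply is_C_derive_eq; [C_deriv|].
unfold chazy_weight, chazy_of_quotient, riccati; field; repeat split; assumption.
Qed.

(* The derivative of [t w / (2 X)] when [r] is the derivative of [v]. *)
Definition chazy_second (x y t w r : C) : C :=
  ((2 * y - 1) * w ^ 2 / (4 * (x * (x - 1)))
   + t * (r + 4) - 4 * t * (t * w / (2 * (x * (x - 1))))) / (2 * (x * (x - 1)))
  - t * w * (2 * x - 1) / (2 * (x * (x - 1)) ^ 2).

Lemma is_C_derive_chazy_slope (v : C -> C) (x : C) :
  chazy_regular x (v x) -> is_C_derive v x (riccati x (v x)) ->
  is_C_derive (fun z => chazy_slope z (v z)) x
    (chazy_second x (chazy_of_quotient x (v x)) (chazy_sqrt x (v x))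
      (chazy_weight x (v x)) (riccati x (v x))).
Proof.
intros Hreg Dv.
assert (DY := is_C_derive_chazy_of_quotient v x Hreg Dv).
assert (DT := is_C_derive_chazy_sqrt v x Hreg Dv).
destruct Hreg as [H0 H1 _ _ _].
assert (H2 : 2 * (x * (x - 1)) <> 0).
{ apply Cmult_neq_0; [apply RtoC_neq_0; lra | now apply Cmult_neq_0]. }
assert (DW : is_C_derive (fun z => chazy_weight z (v z)) x
  (riccati x (v x) - 4 * (chazy_slope x (v x) - 1))).
{ unfold chazy_weight; eapply is_C_derive_eq; [C_deriv | ring]. }
unfold chazy_slope; eapply is_C_derive_eq; [C_deriv|].
unfold chazy_second, chazy_slope; field; auto.
Qed.

Lemma chazy_sqrt_sqr (x v : C) :
  chazy_regular x v ->
  chazy_sqrt x v ^ 2 = chazy_of_quotient x v * (chazy_of_quotient x v - 1).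
Proof.
intros [H0 H1 Hv Ha Hb]; unfold chazy_sqrt, chazy_of_quotient; field; auto.
Qed.

Lemma chazy_riccati (x v : C) :
  chazy_regular x v ->
  (chazy_of_quotient x v - x) * riccati x v
  = chazy_sqrt x v * (v ^ 2 / (4 * (x * (x - 1))) + 1) - v.
Proof.
intros [H0 H1 Hv Ha Hb]; unfold chazy_sqrt, chazy_of_quotient, riccati; field; auto.
Qed.

(** Once [r] and [t ^ 2] are eliminated, both sides are affine in [t] and agree as rational
    functions of [x], [v], [y] and [t]. *)
Lemma PVI_chazy_of_quotient (x v : C) :
  chazy_regular x v -> PVI_regular_value x (chazy_of_quotient x v) ->
  let y := chazy_of_quotient x v in
  let y' := chazy_slope x v in
  chazy_second x y (chazy_sqrt x v) (chazy_weight x v) (riccati x v) =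
    1 / 2 * (1 / y + 1 / (y - 1) + 1 / (y - x)) * y' ^ 2
    - (1 / x + 1 / (x - 1) + 1 / (y - x)) * y'
    + 1 / 2 * (y * (y - 1) * (y - x) / (x ^ 2 * (x - 1) ^ 2))
      * ((2 * (- (1 / 2)) - 1) ^ 2 + x * (x - 1) / (y - x) ^ 2).
Proof.
intros Hreg [Y0 [Y1 Yx]] y y'.
assert (ET := chazy_sqrt_sqr x v Hreg); assert (ER := chazy_riccati x v Hreg).
destruct Hreg as [H0 H1 _ _ _].
assert (Y1' : y - 1 <> 0) by (intros E; now apply Y1, Cminus_eq_0).
assert (Yx' : y - x <> 0) by (intros E; now apply Yx, Cminus_eq_0).
unfold y', chazy_slope, chazy_weight.
fold y in ET, ER, Y0 |- *.
set (t := chazy_sqrt x v) in *; set (r := riccati x v) in *.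
(* [r] enters [chazy_second] only through [t * (r + 4)]; the Riccati relation multiplied by [t]
   removes it and leaves [t] to the first degree. *)
assert (Er : t * (r + 4)
  = (y * (y - 1) * (v ^ 2 / (4 * (x * (x - 1))) + 1) - t * v) / (y - x) + 4 * t).
{ transitivity (t * ((y - x) * r) / (y - x) + 4 * t); [field; exact Yx'|].
  rewrite ER, <- ET; field; auto. }
(* Forgetting how [y], [t] and [r] depend on [x] and [v] keeps the final identity of low degree. *)
clearbody r t y.
set (w := v - 4 * (y - x)).
replace ((t * w / (2 * (x * (x - 1)))) ^ 2)
  with (y * (y - 1) * w ^ 2 / (2 * (x * (x - 1))) ^ 2)
  by (rewrite <- ET; field; auto).
unfold chazy_second; rewrite Er.
replace (4 * t * (t * w / (2 * (x * (x - 1)))))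
  with (2 * (y * (y - 1)) * w / (x * (x - 1)))
  by (rewrite <- ET; field; auto).
unfold w; field; auto.
Qed.

(** * Zeros and poles *)

Definition chazy_den (x f g : C) : C :=
  f * g * (2 * (x - 1) * g + f) * (f + 2 * x * g).

(** The homogeneous form, convertible with [chazy]: it involves no quotient by [g] alone, so
    numerator and denominator can be studied at the zeros of [g]. *)
Definition chazy_value (x f g : C) : C :=
  1 / 8 * ((f + 2 * x * g) ^ 2 - 4 * x * g ^ 2) ^ 2 / chazy_den x f g.

Lemma Cpow_eq_0 (z : C) (n : nat) : z ^ n = 0 -> z = 0.
Proof.
intros E; destruct (classic (z = 0)) as [H|H]; [exact H|].
now destruct (Cpow_nz z n H).
Qed.

(* Every factor below has only simple zeros: if it vanishes together with its
   derivative then so does [g], hence [f]. *)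
Lemma chazy_factors_isolated (U : C -> Prop) (f g : C -> C) (p : C) :
  PVI_domain U -> hypergeometric_system U f g ->
  (forall x, U x -> f x = 0 -> g x <> 0) -> U p ->
  locally' p (fun x => U x /\ chazy_den x (f x) (g x) <> 0 /\
    (f x + 2 * x * g x) ^ 2 - 4 * x * g x ^ 2 <> 0 /\
    f x ^ 2 + 4 * (x - 1) * f x * g x + 4 * x * (x - 1) * g x ^ 2 <> 0 /\
    f x ^ 2 - 4 * x * (x - 1) * g x ^ 2 <> 0).
Proof.
intros HU Hs Hnz Up.
destruct (Hs p Up) as [Df Dg].
destruct HU as [[HO _] [_ HU]]; destruct (HU p Up) as [H0 H1].
assert (H1' : 1 - p <> 0) by (intros K; now apply H1, eq_sym, Cminus_eq_0).
set (h := (f p / 4 - (1 - 2 * p) * g p) / (p * (1 - p))) in Dg.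
(* The hypergeometric equation at [p] solved for [f p], with [h] the derivative of [g]. For the
   compound factors below, this elimination exhibits [g p] or a power of it as a combination of the
   factor and its derivative. *)
assert (Eh : f p = 4 * (p * (1 - p) * h + (1 - 2 * p) * g p))
  by (unfold h; field; auto).
assert (Hf0 : g p = 0 -> f p ^ 2 = 0 -> False).
{ intros Gp Fp; now apply (Hnz p Up), Gp; apply Cpow_eq_0 in Fp. }
assert (If : locally' p (fun x => f x <> 0)).
{ apply (is_C_derive_isolated_zero f p _ Df); intros Fp; now apply Hnz. }
assert (Ig : locally' p (fun x => g x <> 0)).
{ apply (is_C_derive_isolated_zero g p _ Dg); intros Gp Hp; apply (Hf0 Gp).
  rewrite Eh, Gp, Hp; ring. }
assert (Ia : locally' p (fun x => 2 * (x - 1) * g x + f x <> 0)).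
{ eapply is_C_derive_isolated_zero; [C_deriv|]; cbv beta.
  set (a := 2 * (p - 1) * g p + f p).
  intros E D; match type of D with ?d = _ => set (a' := d) in D end.
  assert (Gp : g p = 0).
  { transitivity (p * a' + 1 / 2 * a); [|rewrite D, E; ring].
    unfold a, a'; rewrite Eh; field. }
  apply (Hf0 Gp); replace (f p) with (a - 2 * (p - 1) * g p) by (unfold a; ring).
  rewrite E, Gp; ring. }
assert (Ib : locally' p (fun x => f x + 2 * x * g x <> 0)).
{ eapply is_C_derive_isolated_zero; [C_deriv|]; cbv beta.
  set (b := f p + 2 * p * g p).
  intros E D; match type of D with ?d = _ => set (b' := d) in D end.
  assert (Gp : g p = 0).
  { transitivity ((1 - p) * b' - 1 / 2 * b); [|rewrite D, E; ring].
    unfold b, b'; rewrite Eh; field. }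
  apply (Hf0 Gp); replace (f p) with (b - 2 * p * g p) by (unfold b; ring).
  rewrite E, Gp; ring. }
assert (I0 : locally' p (fun x => (f x + 2 * x * g x) ^ 2 - 4 * x * g x ^ 2 <> 0)).
{ eapply is_C_derive_isolated_zero; [C_deriv|]; cbv beta.
  set (n := (f p + 2 * p * g p) ^ 2 - 4 * p * g p ^ 2).
  intros E D; match type of D with ?d = _ => set (n' := d) in D end.
  assert (Gp : g p = 0).
  { apply (Cpow_eq_0 _ 2); transitivity (1 / 4 * (n' - n / (1 - p)));
      [|rewrite D, E; field; exact H1'].
    unfold n, n'; rewrite Eh; field; exact H1'. }
  apply (Hf0 Gp); rewrite <- E; unfold n; rewrite Gp; ring. }
assert (I1 : locally' p (fun x =>
  f x ^ 2 + 4 * (x - 1) * f x * g x + 4 * x * (x - 1) * g x ^ 2 <> 0)).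
{ eapply is_C_derive_isolated_zero; [C_deriv|]; cbv beta.
  set (n := f p ^ 2 + 4 * (p - 1) * f p * g p + 4 * p * (p - 1) * g p ^ 2).
  intros E D; match type of D with ?d = _ => set (n' := d) in D end.
  assert (Gp : g p = 0).
  { apply (Cpow_eq_0 _ 2); transitivity (- (1 / 4) * (n' + n / p));
      [|rewrite D, E; field; exact H0].
    unfold n, n'; rewrite Eh; field; exact H0. }
  apply (Hf0 Gp); rewrite <- E; unfold n; rewrite Gp; ring. }
assert (Ix : locally' p (fun x => f x ^ 2 - 4 * x * (x - 1) * g x ^ 2 <> 0)).
{ eapply is_C_derive_isolated_zero; [C_deriv|]; cbv beta.
  set (n := f p ^ 2 - 4 * p * (p - 1) * g p ^ 2).
  intros E D; match type of D with ?d = _ => set (n' := d) in D end.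
  assert (Gp : g p = 0).
  (* Here [n' = 4 g (f + (2 p - 1) g)] at [p], and [(2 p - 1)^2 - 4 p (p - 1) = 1] leaves exactly
     [g^3]. *)
  { apply (Cpow_eq_0 _ 3).
    transitivity (g p * n - 1 / 4 * (n' * (f p - (2 * p - 1) * g p)));
      [|rewrite D, E; ring].
    unfold n, n'; rewrite Eh; field. }
  apply (Hf0 Gp); rewrite <- E; unfold n; rewrite Gp; ring. }
generalize (filter_and _ _ (locally'_of_locally _ _ (HO p Up))
  (filter_and _ _ If (filter_and _ _ Ig (filter_and _ _ Ia
    (filter_and _ _ Ib (filter_and _ _ I0 (filter_and _ _ I1 Ix))))))).
apply filter_imp; intros x [Ux [A1 [A2 [A3 [A4 [A5 [A6 A7]]]]]]].
split; [exact Ux | split; [|auto]].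
unfold chazy_den; repeat apply Cmult_neq_0; assumption.
Qed.

Lemma Cdiv_0_r (z : C) : z / 0 = 0.
Proof.
apply injective_projections; simpl; unfold Rdiv; ring.
Qed.

Lemma chazy_den_neq_0 (x f g : C) :
  chazy_den x f g <> 0 ->
  f <> 0 /\ g <> 0 /\ 2 * (x - 1) * g + f <> 0 /\ f + 2 * x * g <> 0.
Proof.
unfold chazy_den; intros H; repeat split; intros E; apply H; rewrite E; ring.
Qed.

Lemma chazy_regular_quotient (x f g : C) :
  x <> 0 -> x <> 1 -> chazy_den x f g <> 0 -> chazy_regular x (f / g).
Proof.
intros H0 H1 Hd; destruct (chazy_den_neq_0 _ _ _ Hd) as [Hf [Hg [Ha Hb]]].
split; [exact H0 | | | |].
- intros E; now apply H1, Cminus_eq_0.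
- intros E; apply Hf; replace f with (f / g * g) by (field; exact Hg).
  rewrite E; ring.
- intros E; apply Ha.
  replace (2 * (x - 1) * g + f) with ((2 * (x - 1) + f / g) * g)
    by (field; exact Hg).
  rewrite E; ring.
- intros E; apply Hb; replace (f + 2 * x * g) with ((f / g + 2 * x) * g)
    by (field; exact Hg).
  rewrite E; ring.
Qed.

(** Numerator and denominator are both homogeneous of degree 4 in [(f, g)], so dividing them by
    [g ^ 4] leaves only [x] and [f / g]. *)
Lemma chazy_value_eq_log (x f g : C) :
  x <> 0 -> x <> 1 -> chazy_den x f g <> 0 ->
  chazy_value x f g = chazy_of_quotient x (f / g).
Proof.
intros H0 H1 Hd.
destruct (chazy_regular_quotient x f g H0 H1 Hd) as [_ _ _ Ra Rb].
destruct (chazy_den_neq_0 _ _ _ Hd) as [Hf [Hg [Ha Hb]]].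
unfold chazy_value, chazy_den, chazy_of_quotient; field; auto 10.
Qed.

Lemma chazy_value_regular (x f g : C) :
  chazy_den x f g <> 0 ->
  (f + 2 * x * g) ^ 2 - 4 * x * g ^ 2 <> 0 ->
  f ^ 2 + 4 * (x - 1) * f * g + 4 * x * (x - 1) * g ^ 2 <> 0 ->
  f ^ 2 - 4 * x * (x - 1) * g ^ 2 <> 0 ->
  PVI_regular_value x (chazy_value x f g).
Proof.
intros Hd H0 H1 Hx.
assert (H8 : 8 * chazy_den x f g <> 0)
  by (apply Cmult_neq_0; [apply RtoC_neq_0; lra | exact Hd]).
assert (Hne : forall a b n : C, n <> 0 ->
  a - b = n ^ 2 / (8 * chazy_den x f g) -> a <> b).
{ intros a b n Hn E ->; apply Hn, (Cpow_eq_0 n 2).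
  replace (n ^ 2) with ((n ^ 2 / (8 * chazy_den x f g)) * (8 * chazy_den x f g))
    by (field; exact Hd).
  rewrite <- E; ring. }
split; [|split]; eapply Hne; [exact H0 | | exact H1 | | exact Hx |];
  unfold chazy_value, chazy_den;
  destruct (chazy_den_neq_0 _ _ _ Hd) as [Hf [Hg [Ha Hb]]]; field; auto.
Qed.

Lemma is_C_derive_quotient_riccati (U : C -> Prop) (f g : C -> C) (x : C) :
  hypergeometric_system U f g -> U x -> x <> 0 -> x <> 1 -> g x <> 0 ->
  is_C_derive (fun z => f z / g z) x (riccati x (f x / g x)).
Proof.
intros Hs Ux H0 H1 Hg; destruct (Hs x Ux) as [Df Dg].
assert (H1' : 1 - x <> 0) by (intros K; now apply H1, eq_sym, Cminus_eq_0).
assert (H1'' : x - 1 <> 0) by (intros K; now apply H1, Cminus_eq_0).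
eapply is_C_derive_eq; [C_deriv|].
unfold riccati; field; auto.
Qed.

Lemma hypergeometric_system_PVI_solution (U : C -> Prop) (f g : C -> C) :
  PVI_domain U -> hypergeometric_system U f g ->
  (forall x, U x -> f x = 0 -> g x <> 0) ->
  PVI_solution (- (1 / 2)) U (fun x => chazy_value x (f x) (g x)).
Proof.
intros HU Hs Hnz.
assert (HO := proj1 (proj1 HU)); assert (H01 := proj2 (proj2 HU)).
assert (Dden : forall x, U x ->
  exists l, is_C_derive (fun z => chazy_den z (f z) (g z)) x l).
{ intros x Ux; destruct (Hs x Ux) as [Df Dg]; eexists.
  unfold chazy_den; C_deriv. }
split; [|split].
- intros p Up.
  exists (fun x => 1 / 8 * ((f x + 2 * x * g x) ^ 2 - 4 * x * g x ^ 2) ^ 2),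
    (fun x => chazy_den x (f x) (g x)).
  split.
  + apply filter_imp with (2 := HO p Up); intros x Ux; split; [|now apply Dden].
    destruct (Hs x Ux) as [Df Dg]; eexists.
    match goal with |- is_derive ?F ?z ?l => change (is_C_derive F z l) end.
    C_deriv.
  + generalize (chazy_factors_isolated U f g p HU Hs Hnz Up).
    apply filter_imp; intros x [_ [Hd _]]; split; [exact Hd | reflexivity].
- intros p Up; generalize (chazy_factors_isolated U f g p HU Hs Hnz Up).
  apply filter_imp; intros x [_ [Hd [N0 [N1 Nx]]]].
  now apply chazy_value_regular.
- intros x Ux _ Hreg.
  set (y := fun x => chazy_value x (f x) (g x)).
  change (PVI_regular_value x (y x)) in Hreg.
  change (ex_derive (C_derive y) x /\ PVI_eq (- (1 / 2)) y x).
  assert (Hd : chazy_den x (f x) (g x) <> 0).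
  (* By the convention [z / 0 = 0], a zero of the denominator gives the value 0, which is not
     regular. *)
  { intros E; apply (proj1 Hreg); unfold y, chazy_value; rewrite E.
    apply Cdiv_0_r. }
  destruct (Dden x Ux) as [l Dl].
  (* The denominator stays nonzero near [x], so the formulas in [v] hold on a neighbourhood, as
     differentiating [C_derive y] requires. *)
  assert (HV := filter_and _ _ (HO x Ux) (is_C_derive_neq_0 _ _ _ Dl Hd)).
  cbv beta in HV; set (v := fun z => f z / g z).
  assert (Dv : forall z, U z -> chazy_den z (f z) (g z) <> 0 ->
    chazy_regular z (v z) /\ is_C_derive v z (riccati z (v z))).
  { intros z Uz Dz; destruct (H01 z Uz) as [Z0 Z1]; split.
    - now apply chazy_regular_quotient.
    - apply (is_C_derive_quotient_riccati U); auto.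
      now apply chazy_den_neq_0 in Dz. }
  assert (Ey : forall z, U z -> chazy_den z (f z) (g z) <> 0 ->
    chazy_of_quotient z (v z) = y z).
  { intros z Uz Dz; destruct (H01 z Uz) as [Z0 Z1]; symmetry.
    now apply chazy_value_eq_log. }
  assert (Dy : locally x (fun z => is_C_derive y z (chazy_slope z (v z)))).
  { apply locally_locally in HV; revert HV; apply filter_imp; intros z HVz.
    destruct (locally_singleton _ _ HVz) as [Uz Dz].
    destruct (Dv z Uz Dz) as [Rz Vz].
    apply is_C_derive_ext_loc with (2 := is_C_derive_chazy_of_quotient v z Rz Vz).
    revert HVz; apply filter_imp; intros w [Uw Dw]; now apply Ey. }
  destruct (Dv x Ux Hd) as [Rx Vx].
  assert (D2 : is_C_derive (C_derive y) x
    (chazy_second x (chazy_of_quotient x (v x)) (chazy_sqrt x (v x))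
      (chazy_weight x (v x)) (riccati x (v x)))).
  { apply is_C_derive_ext_loc with (2 := is_C_derive_chazy_slope v x Rx Vx).
    revert Dy; apply filter_imp; intros z Dz; symmetry.
    exact (is_C_derive_unique _ _ _ Dz). }
  split; [eexists; exact D2|].
  unfold PVI_eq; rewrite (is_C_derive_unique _ _ _ D2).
  rewrite (is_C_derive_unique _ _ _ (locally_singleton _ _ Dy)).
  rewrite <- (Ey x Ux Hd) in Hreg |- *.
  now apply PVI_chazy_of_quotient.
Qed.

Theorem theorem2 :
  (forall x0 : C, x0 <> 0 -> x0 <> 1 ->
     exists (U : C -> Prop) (w1 w2 : C -> C),
       PVI_domain U /\ U x0 /\ hypergeometric_basis U w1 w2) /\
  (forall (U : C -> Prop) (w1 w2 : C -> C),
     PVI_domain U -> hypergeometric_basis U w1 w2 ->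
     forall nu : C, PVI_solution (- (1 / 2)) U (chazy w1 w2 nu)).
Proof.
split; [exact hypergeometric_basis_exists|].
intros U w1 w2 HU [S1 [S2 Hind]] nu.
assert (Hs := hypergeometric_system_comb U _ _ _ _ nu HU
  (hypergeometric_system_of_solution U w1 HU S1)
  (hypergeometric_system_of_solution U w2 HU S2)).
apply (hypergeometric_system_PVI_solution U _ _ HU Hs).
apply (hypergeometric_system_nonzero U _ _ HU Hs).
(* If [nu * w2 + w1] vanished on [U], the coefficients 1 and [nu] would give a linear relation, and
   independence would force [1 = 0]. *)
apply NNPP; intros H; destruct (Hind 1 nu) as [E _].
- intros x Ux; apply NNPP; intros Hx; apply H; exists x; split; [exact Ux|].
  intros E; apply Hx; rewrite <- E; ring.
- apply RtoC_inj in E; lra.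
Qed.
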